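(* Assume $f=u+v$, $f(0)=0$, $g(0)=0$, $h(0)=0$, and that there exist positive constants $\rho,\beta,\overline{\beta},\theta,K,C$ and $a>1$ such that for all $x,y\in\mathbb{R}^d$ $$\langle x-y,u(x)-u(y)\rangle\le-\rho\|x-y\|^2,\qquad \|u(x)-u(y)\|\le K\|x-y\|,$$ $$\langle x-y,v(x)-v(y)\rangle\le-\beta\|x-y\|^{a+1},\qquad \|v(x)\|\le\overline{\beta}\|x\|^a,$$ $$\|g(x)-g(y)\|\le\theta\|x-y\|,\qquad \|h(x)-h(y)\|\le C\|x-y\|.$$ Let $\alpha_1:=-2\rho+\theta^2+\lambda C(2+C)$ and assume moreover $2\beta-\overline{\beta}>0$. Then for any stepsize $\Delta t>0$ with $$\Delta t<\frac{-\alpha_1}{(K+\lambda C)^2}\wedge\frac{2\beta}{[2(K+\lambda C)+\overline{\beta}]\,\overline{\beta}}\wedge\frac{2\beta-\overline{\beta}}{2(K+\lambda C)\overline{\beta}},$$ the numerical solution given by the semi-tamed Euler scheme is exponentially mean-square stable.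
   Context: Setting: the SDE $dX(t)=f(X(t^-))dt+g(X(t^-))dW(t)+h(X(t^-))dN(t)$, $X(0)=X_0$, with $W$ an $m$-dimensional Brownian motion and $N$ a scalar Poisson process with intensity $\lambda>0$, both with respect to a filtration $(\mathcal{F}_t)$ on a complete probability space, $X_0$ $\mathcal{F}_0$-measurable with $\mathbb{E}\|X_0\|^2<\infty$; $f=u+v$, $u,v,h:\mathbb{R}^d\to\mathbb{R}^d$, $g:\mathbb{R}^d\to\mathbb{R}^{d\times m}$; $\overline{N}(t)=N(t)-\lambda t$. $\|\cdot\|$ is the Euclidean norm on vectors and the Frobenius norm on matrices; $s\wedge t=\min(s,t)$. The semi-tamed Euler scheme with stepsize $\Delta t$ is, for $n\ge0$, with $Y_0=X_0$, $$Y_{n+1}=Y_n+\Delta t\,u(Y_n)+\lambda\Delta t\,h(Y_n)+\frac{\Delta t\,v(Y_n)}{1+\Delta t\|v(Y_n)\|}+g(Y_n)\Delta W_n+h(Y_n)\Delta\overline{N}_n,$$ where $\Delta W_n=W((n+1)\Delta t)-W(n\Delta t)$ and $\Delta\overline{N}_n=\overline{N}((n+1)\Delta t)-\overline{N}(n\Delta t)$. The numerical solution is exponentially mean-square stable if there exist constants $\alpha>0$ and $L>0$ such that $\mathbb{E}\|Y_n\|^2\le Le^{-\alpha n\Delta t}\,\mathbb{E}\|X_0\|^2$ for all $n\ge0$. *)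

(* Defs.v *)
From HB Require Import structures.
From mathcomp Require Import all_boot all_order all_algebra.
From mathcomp Require Import all_classical all_reals all_analysis.

Set Implicit Arguments.
Unset Strict Implicit.
Unset Printing Implicit Defensive.

Import Order.TTheory GRing.Theory Num.Theory.
Import numFieldNormedType.Exports.

Local Open Scope classical_set_scope.
Local Open Scope ring_scope.

Section Euclidean.
Context {R : realType}.

(* Euclidean norm on column vectors, Frobenius norm on matrices; the library's
   norm on matrices is the sup norm. *)
Definition enorm {m n : nat} (A : 'M[R]_(m, n)) : R :=
  Num.sqrt (\sum_(i < m) \sum_(j < n) A i j ^+ 2).

Definition dotv {n : nat} (x y : 'cV[R]_n) : R := \sum_(i < n) x i 0 * y i 0.

End Euclidean.

Definition borel (U : topologicalType) : set (set U) :=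
  <<s [set O : set U | open O] >>.
Arguments borel : clear implicits.

(* Measurability of [X] from the sigma-algebra [G] to the sigma-algebra [S],
   both given as families of sets: sub-sigma-algebras of a measurableType have
   no canonical measurableType structure on the same carrier. *)
Definition measurable_wrt {T U : Type} (G : set (set T)) (S : set (set U))
  (X : T -> U) : Prop := forall B, S B -> G (X @^-1` B).

Section Processes.
Context {dT : measure_display} {T : measurableType dT} {R : realType}.
Variable P : probability T R.

Definition filtration (F : R -> set (set T)) : Prop :=
  [/\ forall t : R, 0 <= t -> sigma_algebra setT (F t),
      forall t : R, 0 <= t -> F t `<=` measurable
    & forall s t : R, 0 <= s -> s <= t -> F s `<=` F t].

Definition independent_of {U : Type} (G : set (set T)) (S : set (set U))
    (X : T -> U) : Prop :=
  forall A B, G A -> S B -> P (A `&` X @^-1` B) = (P A * P (X @^-1` B))%E.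

(* The fourth field says that the law of W(t) - W(s) is N(0, (t - s) I_m); the
   second argument of [normal_prob] is the standard deviation. *)
Record brownian_motion (F : R -> set (set T)) (m : nat)
    (W : R -> T -> 'cV[R]_m) : Prop := {
  bm_adapted : forall t : R, 0 <= t -> measurable_wrt (F t) (borel 'cV[R]_m) (W t);
  bm_start : {ae P, forall w, W 0 w = 0};
  bm_indep : forall s t : R, 0 <= s -> s < t ->
    independent_of (F s) (borel 'cV[R]_m) (fun w => W t w - W s w);
  bm_law : forall s t : R, 0 <= s -> s < t ->
    forall B : 'I_m -> set R, (forall i, measurable (B i)) ->
    P [set w | forall i, B i ((W t w - W s w) i 0)] =
    (\prod_(i < m) normal_prob 0 (Num.sqrt (t - s)) (B i))%E;
  bm_path : {ae P, forall w, {within `[0, +oo[, continuous (fun t => W t w)}}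
}.

(* The law of the increments forces the paths to be a.s. nondecreasing. *)
Record poisson_process (F : R -> set (set T)) (lambda : R)
    (N : R -> T -> nat) : Prop := {
  pp_adapted : forall t : R, 0 <= t -> measurable_wrt (F t) [set: set nat] (N t);
  pp_start : {ae P, forall w, N 0 w = 0%N};
  pp_indep : forall s t : R, 0 <= s -> s < t ->
    independent_of (F s) (borel R) (fun w => (N t w)%:R - (N s w)%:R);
  pp_law : forall s t : R, 0 <= s -> s < t -> forall k : nat,
    P [set w | N t w = (N s w + k)%N] = (poisson_pmf (lambda * (t - s)) k)%:E;
  pp_right_continuous : {ae P, forall w, forall t : R, 0 <= t ->
    ((N r w)%:R : R) @[r --> t^'+] --> ((N t w)%:R : R)};
  pp_left_limits : {ae P, forall w, forall t : R, 0 < t ->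
    cvg (((N r w)%:R : R) @[r --> t^'-])}
}.

Definition compensated (lambda : R) (N : R -> T -> nat) (t : R) (w : T) : R :=
  (N t w)%:R - lambda * t.

Section Scheme.
Context {d m : nat}.
Variables (u v h : 'cV[R]_d -> 'cV[R]_d) (g : 'cV[R]_d -> 'M[R]_(d, m)).
Variables (lambda : R) (W : R -> T -> 'cV[R]_m) (N : R -> T -> nat).
Variables (X0 : T -> 'cV[R]_d) (dt : R).

Fixpoint semi_tamed_euler (n : nat) (w : T) : 'cV[R]_d :=
  match n with
  | 0 => X0 w
  | k.+1 =>
    let Y := semi_tamed_euler k w in
    let dW := W (k.+1%:R * dt) w - W (k%:R * dt) w in
    let dN := compensated lambda N (k.+1%:R * dt) w
              - compensated lambda N (k%:R * dt) w in
    Y + dt *: u Y + (lambda * dt) *: h Y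
      + (dt / (1 + dt * enorm (v Y))) *: v Y
      + g Y *m dW + dN *: h Y
  end.

End Scheme.

Definition exp_mean_square_stable {d : nat} (X0 : T -> 'cV[R]_d) (dt : R)
    (Y : nat -> T -> 'cV[R]_d) : Prop :=
  exists alpha L : R, [/\ 0 < alpha, 0 < L &
    forall n : nat,
      ('E_P[fun w => (enorm (Y n w) ^+ 2)%R] <=
       (L * expR (- alpha * n%:R * dt))%:E *
       'E_P[fun w => (enorm (X0 w) ^+ 2)%R])%E].

End Processes.

(* Main.v *)
Require Import Defs.
From HB Require Import structures.
From mathcomp Require Import all_boot all_order all_algebra.
From mathcomp Require Import all_classical all_reals all_analysis.
From mathcomp Require Import measurable_realfun.
From mathcomp Require Import ring lra.

Import Order.TTheory GRing.Theory Num.Theory.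
Import numFieldNormedType.Exports.

Local Open Scope classical_set_scope.
Local Open Scope ring_scope.

(** Write x for the current iterate, D for the stepsize and A = K + lambda C. The
    new iterate is b(x) + g(x) dW + h(x) dM, where b(x) is the deterministic part
    of the step and M is the compensated Poisson process. The coefficients depend
    on the past, and the increments dW_1, ..., dW_m, dM are centred, independent
    of the past and pairwise orthogonal, so that
      E |Y'|^2 <= E [ |b(Y)|^2 + D |g(Y)|^2 + lambda D |h(Y)|^2 ].
    The growth bound on v gives v 0 = 0, hence u 0 = f 0 - v 0 = 0, so the
    Lipschitz coefficients are bounded by multiples of |x|. In |b(x)|^2 the three terms that contain the tamed drift
    have a nonpositive sum: the dissipation - 2 beta |x|^(a + 1) pays for the
    square of the tamed drift and for its interaction with u + lambda h. For
    |x| <= 1 this uses |x|^(2a) <= |x|^(a + 1) and the second bound on D; for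
    |x| >= 1 it uses that the tamed drift has norm at most 1 and the third bound
    ([tamed_drift_bound]). What is left is the linear part, and
      E |Y'|^2 <= (1 + D alpha1 + D^2 A^2) E |Y|^2,
    where the first bound on D makes the factor less than 1
    ([euler_step_moment], [euler_stable]).

    The delicate point is that dW and dM are orthogonal. Independence of W and N
    is not a hypothesis: it is a consequence of their being a Brownian motion and
    a Poisson process for one and the same filtration. The special case needed
    here, E [Z dW dM] = 0 for Z known at the start of the step, has an elementary
    proof ([orthogonal_increments]). Cutting the step into k pieces, the
    products of increments over different pieces have mean zero, and on one piece
    of length r the elementary inequality |x| n <= n^2 / J + J^3 x^4, valid for
    every integer n >= 0, bounds the product by a multiple of r / J + J^3 r^2;
    with J^4 = k the sum over the pieces is of order 1 / J, for every J.

    The moments of the normal law that enter here (mean, variance, fourth moment)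
    are read off from exponential moments, which only amount to recognizing
    another normal density in the integrand. *)

Set Implicit Arguments.
Unset Strict Implicit.
Unset Printing Implicit Defensive.

(** * Independence and expectations of products *)

Section Independence.
Context {dT : measure_display} {T : measurableType dT} {R : realType}.
Variable P : probability T R.

Definition independent d1 d2 (T1 : measurableType d1) (T2 : measurableType d2)
    (X : T -> T1) (Y : T -> T2) := forall A B,
  measurable A -> measurable B ->
  P (X @^-1` A `&` Y @^-1` B) = (P (X @^-1` A) * P (Y @^-1` B))%E.

Local Notation law X := (distribution P X).

Section JointLaw.
Context d1 d2 (T1 : measurableType d1) (T2 : measurableType d2).
Variables (X : {RV P >-> T1}) (Y : {RV P >-> T2}).

(** A finite measure on a product is determined by its values on rectangles, and
    independence is the product formula on rectangles. *)
Lemma joint_law : independent X Y ->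
  forall C : set (T1 * T2), measurable C ->
    (law X \x law Y)%E C = P [set w | C (X w, Y w)].
Proof.
move=> indXY C mC.
have mXY : measurable_fun setT (fun w => (X w, Y w)).
  exact/measurable_fun_pair.
pose XY : {mfun T >-> (T1 * T2)%type} := HB.pack (fun w => (X w, Y w))
  (isMeasurableFun.Build _ _ _ _ _ mXY).
exact: (@product_measure_unique _ _ _ _ _ (law X) (law Y) (pushforward P XY)).
Qed.

Lemma independent_integral (f : T1 * T2 -> \bar R) :
  independent X Y -> measurable_fun setT f -> (forall z, 0 <= f z)%E ->
  (\int[P]_w f (X w, Y w) = \int[law X]_x \int[law Y]_y f (x, y))%E.
Proof.
move=> indXY mf f0.
have mXY : measurable_fun setT (fun w => (X w, Y w)).
  exact/measurable_fun_pair.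
pose XY : {mfun T >-> (T1 * T2)%type} := HB.pack (fun w => (X w, Y w))
  (isMeasurableFun.Build _ _ _ _ _ mXY).
rewrite -fubini_tonelli1//.
rewrite (@eq_measure_integral _ _ _ _ (pushforward P XY)); last first.
  by move=> A mA _; exact: joint_law.
by rewrite ge0_integral_pushforward.
Qed.

End JointLaw.

(** Fubini for the joint law: Tonelli applied to |x y| gives integrability of the
    product, which is not assumed, and Fubini then factors the integral. *)
Lemma independent_mean (X Y : {RV P >-> R}) : independent X Y ->
  P.-integrable setT (EFin \o X) -> P.-integrable setT (EFin \o Y) ->
  P.-integrable setT (EFin \o (X \* Y)) /\
  \int[P]_w (X w * Y w) = \int[P]_w X w * \int[P]_w Y w.
Proof.
move=> indXY iX iY.
pose f : R * R -> \bar R := fun z => (z.1 * z.2)%:E.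
have mf : measurable_fun setT f by apply/measurable_EFinP/measurable_funM.
have mXY : measurable_fun setT (fun w => (X w, Y w)).
  exact/measurable_fun_pair.
pose XY : {mfun T >-> (R * R)%type} := HB.pack (fun w => (X w, Y w))
  (isMeasurableFun.Build _ _ _ _ _ mXY).
have iXl : (law X).-integrable setT EFin by apply: integrable_pushforward.
have iYl : (law Y).-integrable setT EFin by apply: integrable_pushforward.
have if_ : (law X \x law Y)%E.-integrable setT f.
  apply/integrable12ltyP => //.
  under eq_integral => x _.
    under eq_integral do rewrite /f /= normrM EFinM.
    rewrite ge0_integralZl//=; last first.
      by apply/measurable_EFinP; exact: normr_measurable.
    over.
  rewrite ge0_integralZr//=.
  - apply: lte_mul_pinfty => //.
    + exact: integral_ge0.
    + by have := integrable_abse iXl; exact: integrable_fin_num.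
    + by case/integrableP: iYl.
  - by apply/measurable_EFinP; exact: normr_measurable.
  - exact: integral_ge0.
have iJ : P.-integrable setT (EFin \o (X \* Y)).
  apply/integrableP; split.
    by apply/measurable_EFinP/measurable_funM.
  rewrite (@independent_integral _ _ _ _ X Y (abse \o f))//.
  - by have /integrable12ltyP := if_; apply.
  - exact: measurableT_comp.
  - by move=> z; exact: abse_ge0.
split=> //.
rewrite /Rintegral -fineM; [|exact: integrable_fin_num..].
congr fine.
transitivity (\int[(law X \x law Y)%E]_z f z)%E.
  rewrite (@eq_measure_integral _ _ _ _ (pushforward P XY)); last first.
    by move=> A mA _; exact: joint_law.
  by rewrite integral_pushforward.
rewrite -integral12_prod_meas1//.
rewrite /fubini_F/=.
under eq_integral => x _.
  rewrite /f /=.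
  under eq_integral do rewrite EFinM.
  rewrite integralZl//.
  over.
rewrite /= -[X in _ = (_ * X)%E](@integral_distribution _ _ _ _ _ _ Y EFin)//.
rewrite -[X in _ = (X * _)%E](@integral_distribution _ _ _ _ _ _ X EFin)//.
rewrite -(fineK (integrable_fin_num _ iYl))//.
by rewrite integralZr.
Qed.
End Independence.

(** * Integrable and square-integrable random variables *)

Section L1.
Context {dT : measure_display} {T : measurableType dT} {R : realType}.
Variable P : probability T R.

Definition L1 (X : T -> R) := P.-integrable setT (EFin \o X).
Definition L2 (X : T -> R) := measurable_fun setT X /\ L1 (fun w => X w ^+ 2).
Definition mean (X : T -> R) := \int[P]_w X w.

Lemma L1_measurable (X : T -> R) : L1 X -> measurable_fun setT X.
Proof. by move=> /measurable_int/measurable_EFinP. Qed.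

Lemma L1_le (X Y : T -> R) : measurable_fun setT X ->
  (forall w, `|X w| <= Y w) -> L1 Y -> L1 X.
Proof.
move=> mX XY; apply: (le_integrable measurableT); first exact/measurable_EFinP.
by move=> w _ /=; rewrite lee_fin (le_trans (XY w))// ler_norm.
Qed.

Lemma L1_cst (c : R) : L1 (cst c).
Proof. exact: finite_measure_integrable_cst. Qed.

Lemma L1D (X Y : T -> R) : L1 X -> L1 Y -> L1 (fun w => X w + Y w).
Proof. by move=> iX iY; exact: (integrableD measurableT iX iY). Qed.

Lemma L1Z (c : R) (X : T -> R) : L1 X -> L1 (fun w => c * X w).
Proof. by move=> iX; exact: (integrableZl measurableT c iX). Qed.

Lemma L1_norm (X : T -> R) : L1 X -> L1 (fun w => `|X w|).
Proof. exact: integrable_norm. Qed.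

Lemma L1_sum (I : Type) (r : seq I) (X : I -> T -> R) :
  (forall i, L1 (X i)) -> L1 (fun w => \sum_(i <- r) X i w).
Proof.
move=> iX; elim: r => [|i r IH].
  by under eq_fun do rewrite big_nil; exact: L1_cst.
by under eq_fun do rewrite big_cons; exact: L1D.
Qed.

Lemma mean_cst (c : R) : mean (cst c) = c.
Proof.
by have := expectation_cst P c; rewrite unlock => /(congr1 fine).
Qed.

Lemma meanD (X Y : T -> R) : L1 X -> L1 Y ->
  mean (fun w => X w + Y w) = mean X + mean Y.
Proof. exact: RintegralD. Qed.

Lemma meanB (X Y : T -> R) : L1 X -> L1 Y ->
  mean (fun w => X w - Y w) = mean X - mean Y.
Proof. exact: RintegralB. Qed.

Lemma meanZ (c : R) (X : T -> R) : L1 X -> mean (fun w => c * X w) = c * mean X.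
Proof. exact: RintegralZl. Qed.

Lemma mean_sum (I : Type) (r : seq I) (X : I -> T -> R) :
  (forall i, L1 (X i)) ->
  mean (fun w => \sum_(i <- r) X i w) = \sum_(i <- r) mean (X i).
Proof.
move=> iX; elim: r => [|i r IH].
  by under eq_fun do rewrite big_nil; rewrite big_nil (mean_cst 0).
under eq_fun do rewrite big_cons; rewrite big_cons meanD ?IH//.
exact: L1_sum.
Qed.

Lemma mean_le (X Y : T -> R) : L1 X -> L1 Y -> (forall w, X w <= Y w) ->
  mean X <= mean Y.
Proof. by move=> iX iY XY; exact: le_Rintegral. Qed.

Lemma mean_ge0 (X : T -> R) : (forall w, 0 <= X w) -> 0 <= mean X.
Proof. by move=> X0; exact: Rintegral_ge0. Qed.

Lemma L2_cst (c : R) : L2 (cst c).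
Proof. by split=> //; exact: (L1_cst (c ^+ 2)). Qed.

Lemma L2M (X Y : T -> R) : L2 X -> L2 Y -> L1 (fun w => X w * Y w).
Proof.
move=> [mX iX] [mY iY]; apply: (@L1_le _ (fun w => X w ^+ 2 + Y w ^+ 2)).
- exact: measurable_funM.
- by move=> w; rewrite ler_norml; nra.
- exact: L1D.
Qed.

Lemma L2_L1 (X : T -> R) : L2 X -> L1 X.
Proof.
by move=> /L2M/(_ (L2_cst 1)); under eq_fun do rewrite mulr1.
Qed.

Lemma L2D (X Y : T -> R) : L2 X -> L2 Y -> L2 (fun w => X w + Y w).
Proof.
move=> [mX iX] [mY iY]; split; first exact: measurable_funD.
apply: (@L1_le _ (fun w => 2 * X w ^+ 2 + 2 * Y w ^+ 2)).
- by apply: measurable_funX; exact: measurable_funD.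
- move=> w; rewrite ger0_norm ?sqr_ge0//.
  have := sqr_ge0 (X w - Y w); rewrite !expr2; nra.
- by apply: L1D; exact: L1Z.
Qed.

Lemma L2_sum (I : Type) (r : seq I) (X : I -> T -> R) :
  (forall i, L2 (X i)) -> L2 (fun w => \sum_(i <- r) X i w).
Proof.
move=> iX; elim: r => [|i r IH].
  by under eq_fun do rewrite big_nil; exact: L2_cst.
by under eq_fun do rewrite big_cons; exact: L2D.
Qed.

(** Expanding the square leaves only the diagonal. *)
Lemma pythagoras (I : finType) (X : I -> T -> R) :
  (forall i, L2 (X i)) ->
  (forall i j, i != j -> mean (fun w => X i w * X j w) = 0) ->
  mean (fun w => (\sum_i X i w) ^+ 2) = \sum_i mean (fun w => X i w ^+ 2).
Proof.
move=> iX orth.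
transitivity (mean (fun w => \sum_i \sum_j X i w * X j w)).
  by congr mean; apply/funext => w; rewrite expr2 big_distrlr/=.
rewrite mean_sum; last by move=> i; apply: L1_sum => j; exact: L2M.
apply: eq_bigr => i _; rewrite mean_sum; last by move=> j; exact: L2M.
by rewrite (bigD1 i)//= big1 ?addr0// => j ji; rewrite orth// eq_sym.
Qed.

Lemma independent_meanM (X Y : T -> R) : independent P X Y -> L1 X -> L1 Y ->
  L1 (fun w => X w * Y w) /\ mean (fun w => X w * Y w) = mean X * mean Y.
Proof.
move=> indXY iX iY.
pose X' : {RV P >-> R} := HB.pack X
  (isMeasurableFun.Build _ _ _ _ _ (L1_measurable iX)).
pose Y' : {RV P >-> R} := HB.pack Y
  (isMeasurableFun.Build _ _ _ _ _ (L1_measurable iY)).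
exact: (@independent_mean _ _ _ _ X' Y').
Qed.

End L1.

(** * Borel maps on column vectors and adapted variables *)

Section Borel.
Context {R : realType}.

Lemma borelRE : borel R = measurable.
Proof.
apply/seteqP; split.
  apply: smallest_sub; first exact: sigma_algebra_measurable.
  by move=> O /open_measurable.
rewrite [X in X `<=` _](RGenOpens.measurableE R).
apply: smallest_sub; first exact: smallest_sigma_algebra.
by move=> _ [x [y ->]]; apply: sub_sigma_algebra; exact: interval_open.
Qed.

(** The Borel sigma-algebra of column vectors as a measurable type, which gives
    access to composition of measurable maps. *)
Definition borelType (d : nat) :=
  g_sigma_algebraType [set O : set 'cV[R]_d | open O].

Lemma continuous_borel d (phi : 'cV[R]_d -> R) : continuous phi ->
  measurable_fun [set: borelType d] phi.
Proof.
move=> /continuousP cphi.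
apply: (measurability _ (esym borelRE)) => _ [V oV <-].
by rewrite setTI; apply: sub_sigma_algebra; exact: cphi.
Qed.

End Borel.

Section Adapted.
Context {dT : measure_display} {T : measurableType dT} {R : realType}.
Variable (G : set (set T)).
Hypothesis sG : sigma_algebra setT G.

(** [G] is made into the sigma-algebra of an alias of [T], so that the closure
    properties of measurable functions apply to variables measurable for a
    sub-sigma-algebra. *)
Definition adapted (Z : T -> R) :=
  measurable_fun [set: g_sigma_algebraType G] Z.

Lemma adaptedP (Z : T -> R) :
  adapted Z <-> forall B, measurable B -> G (Z @^-1` B).
Proof.
rewrite /adapted; split => [mZ B mB|mZ _ B mB].
  have := mZ measurableT B mB; rewrite setTI.
  by rewrite (measurable_g_measurableTypeE sG).
by rewrite setTI (measurable_g_measurableTypeE sG); exact: mZ.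
Qed.

Lemma adapted_measurable (Z : T -> R) : G `<=` measurable -> adapted Z ->
  measurable_fun setT Z.
Proof. by move=> Gm /adaptedP aZ _ B mB; rewrite setTI; exact/Gm/aZ. Qed.

Lemma adapted_coord d (Y : T -> 'cV[R]_d) :
  measurable_wrt G (borel 'cV[R]_d) Y -> forall i, adapted (fun w => Y w i 0).
Proof.
move=> mY i; apply/adaptedP => B mB; apply: (mY [set x | B (x i 0)]).
have := @continuous_borel R d (fun x => x i 0) (@coord_continuous _ _ _ i 0).
by move=> /(_ measurableT B mB); rewrite setTI.
Qed.

(** Every open set is the union of the countably many cubes with rational centre
    and side that it contains, and the preimage of a cube is a finite intersection
    of conditions on the coordinates. *)
Lemma coord_adapted d (Y : T -> 'cV[R]_d) : (forall i, adapted (fun w => Y w i 0)) ->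
  measurable_fun [set: g_sigma_algebraType G]
    (Y : g_sigma_algebraType G -> @borelType R d).
Proof.
move=> aY.
apply: (@measurability _ _ (g_sigma_algebraType G) (@borelType R d) setT Y
  [set V : set 'cV[R]_d | open V]) => //.
move=> _ [V oV <-]; rewrite setTI.
pose box (p : 'cV[rat]_d * nat) : set 'cV[R]_d :=
  [set x | forall i, `|x i 0 - ratr (p.1 i 0)| < p.2.+1%:R^-1].
pose inV p := box p `<=` V.
have -> : Y @^-1` V = \bigcup_p (if `[< inV p >] then Y @^-1` (box p) else set0).
  apply/seteqP; split => w /=; last first.
    by case=> p _; case: ifPn => // /asboolP; exact.
  move=> VYw.
  have /nbhs_ballP[e e0 eV] : nbhs (Y w) V by apply: open_nbhs_nbhs; split.
  (* Two points of a cube of half-side 1 / (n + 1) are less than e apart. *)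
  have [n n_e] : exists n, 2 * n.+1%:R^-1 < e.
    exists (Num.truncn (2 / e)); rewrite ltr_pdivrMr// mulrC -ltr_pdivrMr//.
    exact: truncnS_gt.
  have /choice[q qP] : forall i : 'I_d, exists q : rat,
      `|Y w i 0 - ratr q| < n.+1%:R^-1.
    move=> i; have : Y w i 0 - n.+1%:R^-1 < Y w i 0 + n.+1%:R^-1.
      by rewrite ltrD2l gtrN// invr_gt0.
    move=> /rat_in_itvoo[q]; rewrite in_itv/= => /andP[q1 q2]; exists q.
    by rewrite distrC ltr_distl q1.
  exists ((\col_i q i), n) => //.
  case: ifPn => [_|/asboolP].
    by move=> i; rewrite mxE.
  case; move=> x bx; apply: eV; split => // i j; rewrite ord1 /ball/=.
  apply: le_lt_trans n_e; rewrite mulr_natl mulr2n.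
  rewrite -(subrKA (ratr (q i))) (le_trans (ler_normD _ _))// lerD//.
    exact/ltW/qP.
  by have := bx i; rewrite mxE distrC => /ltW.
apply: countable_bigcupT_measurable => // p; case: ifPn => // _.
have -> : Y @^-1` box p = \bigcap_(i in [set: 'I_d])
    (fun w => Y w i 0) @^-1` [set r | `|r - ratr (p.1 i 0)| < p.2.+1%:R^-1].
  by apply/seteqP; split => [w bw i _ /=|w bw i]; [exact: bw|exact: bw].
apply: fin_bigcap_measurable => // i _; rewrite -[X in measurable X]setTI.
apply: aY => //.
have -> : [set r : R | `|r - ratr (p.1 i 0)| < p.2.+1%:R^-1] =
    ball (ratr (p.1 i 0) : R) p.2.+1%:R^-1.
  by apply/seteqP; split => r /=; rewrite /ball/= distrC.
exact: measurable_ball.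
Qed.

End Adapted.

Lemma adapted_mono {dT : measure_display} {T : measurableType dT} {R : realType}
    (G H : set (set T)) (Z : T -> R) :
  sigma_algebra setT G -> sigma_algebra setT H -> G `<=` H ->
  adapted G Z -> adapted H Z.
Proof.
move=> sG sH GH /(adaptedP sG) aZ; apply/(adaptedP sH) => B mB.
by apply: GH; exact: aZ.
Qed.

Section Filtration.
Context {dT : measure_display} {T : measurableType dT} {R : realType}.
Variable F : R -> set (set T).
Hypothesis HF : filtration F.
Implicit Types s t : R.

Lemma filtration_sigma t : 0 <= t -> sigma_algebra setT (F t).
Proof. by case: HF => + _ _; exact. Qed.

Lemma filtration_adapted s t (Z : T -> R) :
  0 <= s -> s <= t -> adapted (F s) Z -> adapted (F t) Z.
Proof.
move=> s0 st; have t0 := le_trans s0 st; case: (HF) => _ _ mono.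
by apply: adapted_mono; [exact: filtration_sigma|exact: filtration_sigma|exact: mono].
Qed.

Lemma filtration_measurable t (Z : T -> R) :
  0 <= t -> adapted (F t) Z -> measurable_fun setT Z.
Proof.
move=> t0; apply: adapted_measurable; first exact: filtration_sigma.
by case: HF => _ + _; exact.
Qed.

End Filtration.

(** * Moments of the normal law *)

Section Density.
Context {d : measure_display} {T : measurableType d} {R : realType}.
Variables (nu mu : {measure set T -> \bar R}) (p : T -> R).
Hypothesis (mp : measurable_fun setT p) (p0 : forall x, 0 <= p x).
Hypothesis nuE : forall A, measurable A ->
  nu A = (\int[mu]_(x in A) (p x)%:E)%E.

Import HBNNSimple.

(** By linearity it is enough to treat the indicator of a level set of [f], for
    which the claim is the definition of the density. *)
Lemma integral_density_nnsfun (f : {nnsfun T >-> R}) :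
  (\int[nu]_x (f x)%:E = \int[mu]_x ((f x)%:E * (p x)%:E))%E.
Proof.
under [LHS]eq_integral do rewrite fimfunE -fsumEFin//.
rewrite [LHS]ge0_integral_fsum//; last 2 first.
  - by move=> r; exact/measurable_EFinP/measurableT_comp.
  - by move=> n x _; rewrite ?EFinM nnfun_muleindic_ge0.
under [RHS]eq_integral.
  move=> x xD; rewrite fimfunE -fsumEFin// ge0_mule_fsuml; last first.
    by move=> r; rewrite ?EFinM nnfun_muleindic_ge0.
  over.
rewrite [RHS]ge0_integral_fsum//; last 2 first.
  - move=> r; apply/emeasurable_funM; last exact/measurable_EFinP.
    by apply/measurable_EFinP/measurableT_comp.
  - by move=> n x _; rewrite mule_ge0 ?EFinM ?nnfun_muleindic_ge0 ?lee_fin.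
apply: eq_fsbigr => r _.
have mfr : measurable (f @^-1` [set r]) by exact: measurable_funPTI.
rewrite integralZl_indic_nnsfun// integral_indic// setIT nuE//.
have [r0|r0] := ltP r 0.
  rewrite [f @^-1` _](_ : _ = set0); last first.
    by apply/seteqP; split => // x /= fx; move: r0; rewrite -fx ltNge fun_ge0.
  rewrite integral_set0 mule0 integral0_eq// => x _.
  by rewrite indic0 mulr0 mul0e.
rewrite integral_mkcond -ge0_integralZl//; last 2 first.
- by apply/(measurable_restrictT _ _).1 => //; apply/measurable_funTS/measurable_EFinP.
- by move=> x _; rewrite patchE; case: ifPn => //; rewrite lee_fin.
apply: eq_integral => x _; rewrite patchE indicE.
by case: ifPn => _; rewrite ?mulr1 ?mulr0 ?mul0e ?mule0.
Qed.

(** The formula for simple functions passes to nonnegative functions by monotone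
    convergence on both sides. *)
Lemma ge0_integral_density (f : T -> \bar R) :
  measurable_fun setT f -> (forall x, 0 <= f x)%E ->
  (\int[nu]_x f x = \int[mu]_x (f x * (p x)%:E))%E.
Proof.
move=> mf f0.
pose f_ := nnsfun_approx measurableT mf.
transitivity (lim (\int[nu]_x (f_ n x)%:E @[n --> \oo])%E).
  rewrite -monotone_convergence//=.
  - apply: eq_integral => ? /[!inE] xD; apply/esym/cvg_lim => //=.
    exact: cvg_nnsfun_approx.
  - by move=> n; exact/measurable_EFinP/measurable_funTS.
  - by move=> n ? _; rewrite lee_fin.
  - by move=> ? _ ? ? mn; rewrite lee_fin; exact/lefP/nd_nnsfun_approx.
under eq_fun do rewrite integral_density_nnsfun.
rewrite -monotone_convergence//=.
- apply: eq_integral => x _; apply/cvg_lim => //=.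
  by apply: cvgeZr => //; exact: cvg_nnsfun_approx.
- move=> n; apply: emeasurable_funM; last exact/measurable_EFinP.
  exact/measurable_EFinP/measurable_funTS.
- by move=> n ? _; rewrite mule_ge0// lee_fin.
- move=> x _ m n mn; rewrite lee_wpmul2r ?lee_fin//.
  exact/lefP/nd_nnsfun_approx.
Qed.

End Density.

Section NormalPdf.
Context {R : realType}.
Implicit Types sigma r t x : R.

(** Completing the square: an exponential weight shifts the mean of a centred
    normal density. *)
Lemma normal_pdf_tilt sigma t x : 0 < sigma ->
  expR (t * x) * normal_pdf 0 sigma x =
  expR (t ^+ 2 * sigma ^+ 2 / 2) * normal_pdf (t * sigma ^+ 2) sigma x.
Proof.
move=> s0; rewrite !normal_pdfE ?gt_eqF//= !(mulrCA (expR _)) /normal_fun -!expRD.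
congr (_ * expR _); field.
by rewrite gt_eqF.
Qed.

(** A Gaussian weight changes the standard deviation; the weight is parametrized
    by the ratio [r] of the two deviations, so that no square root appears. *)
Lemma normal_pdf_widen sigma r x : 0 < sigma -> 0 < r ->
  expR ((1 - r ^+ 2) * x ^+ 2 / (2 * sigma ^+ 2)) * normal_pdf 0 sigma x =
  r^-1 * normal_pdf 0 (sigma / r) x.
Proof.
move=> s0 r0; have sr0 : 0 < sigma / r by exact: divr_gt0.
rewrite !normal_pdfE ?gt_eqF//= mulrCA [in RHS]mulrA /normal_fun -!expRD.
congr (_ * expR _); last first.
  by field; rewrite !gt_eqF.
have peakE s : 0 < s -> normal_peak s = s^-1 * (Num.sqrt (pi *+ 2))^-1.
  move=> s_gt0; rewrite /normal_peak -mulrnAr sqrtrM ?sqr_ge0//.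
  by rewrite sqrtr_sqr gtr0_norm// invfM.
rewrite !peakE//; field.
by rewrite !gt_eqF// sqrtr_gt0 mulrn_wgt0// pi_gt0.
Qed.

End NormalPdf.

Section NormalMoments.
Context {dT : measure_display} {T : measurableType dT} {R : realType}.
Variable P : probability T R.
Variables (X : T -> R) (sigma : R).
Hypotheses (mX : measurable_fun setT X) (s0 : 0 < sigma).
Hypothesis lawX : forall B, measurable B -> P (X @^-1` B) = normal_prob 0 sigma B.

Lemma integral_normal (f : R -> R) : measurable_fun setT f ->
  (forall x, 0 <= f x) ->
  (\int[P]_w (f (X w))%:E =
   \int[lebesgue_measure]_x (f x * normal_pdf 0 sigma x)%:E)%E.
Proof.
move=> mf f0.
have mX_ : measurable_fun setT (X : T -> measurableTypeR R) by exact: mX.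
pose X' : {RV P >-> measurableTypeR R} :=
  HB.pack X (isMeasurableFun.Build _ _ _ _ _ mX_).
have mEf : measurable_fun [set: measurableTypeR R] (EFin \o f).
  exact/measurable_EFinP.
transitivity (\int[normal_prob 0 sigma]_x (f x)%:E)%E.
  rewrite -(@ge0_integral_distribution _ _ _ _ _ _ X' (EFin \o f))//.
  by apply: eq_measure_integral => /= A mA _; exact: lawX.
rewrite (@ge0_integral_density _ _ _ _ lebesgue_measure (normal_pdf 0 sigma))//.
- exact: measurable_normal_pdf.
- exact: normal_pdf_ge0.
Qed.

(** The exponential of a quadratic is integrated by [normal_pdf_widen] and the
    normalization of the wider density. *)
Lemma normal_exp_quadratic r : 0 < r ->
  let Z w := expR ((1 - r ^+ 2) * X w ^+ 2 / (2 * sigma ^+ 2)) in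
  L1 P Z /\ mean P Z = r^-1.
Proof.
move=> r0 Z.
have mZ : measurable_fun setT Z.
  apply: measurableT_comp => //; apply: measurable_funM => //.
  by apply: measurable_funM => //; exact: measurable_funX.
have EZ : (\int[P]_w (Z w)%:E = r^-1%:E)%E.
  rewrite (@integral_normal (fun x => expR ((1 - r ^+ 2) * x ^+ 2 / (2 * sigma ^+ 2)))).
  - under eq_integral do rewrite normal_pdf_widen// EFinM.
    rewrite ge0_integralZl//; first by rewrite integral_normal_pdf mule1.
    + by apply/measurable_EFinP; exact: measurable_normal_pdf.
    + by move=> x _; rewrite lee_fin normal_pdf_ge0.
    + by rewrite lee_fin invr_ge0 ltW.
  - apply: measurableT_comp => //; apply: measurable_funM => //.
    by apply: measurable_funM => //; exact: measurable_funX.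
  - by move=> x; exact: expR_ge0.
split; last by rewrite /mean /Rintegral EZ.
apply/integrableP; split; first exact/measurable_EFinP.
under eq_integral do rewrite /= ger0_norm ?expR_ge0//.
by rewrite EZ ltry.
Qed.

Lemma normal_exp_linear t :
  let Z w := expR (t * X w) in
  L1 P Z /\ mean P Z = expR (t ^+ 2 * sigma ^+ 2 / 2).
Proof.
move=> Z.
have mZ : measurable_fun setT Z.
  by apply: measurableT_comp => //; exact: measurable_funM.
have EZ : (\int[P]_w (Z w)%:E = (expR (t ^+ 2 * sigma ^+ 2 / 2))%:E)%E.
  rewrite (@integral_normal (fun x => expR (t * x))).
  - under eq_integral do rewrite normal_pdf_tilt// EFinM.
    rewrite ge0_integralZl//; first by rewrite integral_normal_pdf mule1.
    + by apply/measurable_EFinP; exact: measurable_normal_pdf.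
    + by move=> x _; rewrite lee_fin normal_pdf_ge0.
  - by apply: measurableT_comp => //; exact: measurable_funM.
  - by move=> x; exact: expR_ge0.
split; last by rewrite /mean /Rintegral EZ.
apply/integrableP; split; first exact/measurable_EFinP.
under eq_integral do rewrite /= ger0_norm ?expR_ge0//.
by rewrite EZ ltry.
Qed.

(** For a >= 0, a^2 / 4 is at most exp a; take a to be the quadratic exponent with
    r = 1 / 2, whose exponential has mean 2. The constant 64 is not optimal; only
    the order sigma^4 matters. *)
Lemma normal_moment4 :
  L1 P (fun w => X w ^+ 4) /\ mean P (fun w => X w ^+ 4) <= 64 * sigma ^+ 4.
Proof.
pose Z w := expR ((1 - 2^-1 ^+ 2) * X w ^+ 2 / (2 * sigma ^+ 2)).
have [iZ EZ] : L1 P Z /\ mean P Z = 2^-1^-1.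
  by apply: normal_exp_quadratic; rewrite invr_gt0.
have XZ w : X w ^+ 4 <= 32 * sigma ^+ 4 * Z w.
  rewrite /Z; set a := _ / _.
  have a0 : 0 <= a.
    apply: divr_ge0; last by rewrite pmulr_rge0// sqr_ge0.
    by apply: mulr_ge0; [lra|exact: sqr_ge0].
  have -> : X w ^+ 4 = 64 / 9 * a ^+ 2 * sigma ^+ 4.
    by rewrite /a; field; rewrite gt_eqF.
  have := expR_ge1Dx (a / 2).
  rewrite -(ler_pXn2r (n := 2))// ?nnegrE ?expR_ge0//; last by lra.
  rewrite -expRM_natl -[2%:R * _]mulrC divfK// => ea.
  rewrite [leRHS]mulrAC ler_pM2r ?exprn_gt0//.
  nra.
have iX4 : L1 P (fun w => X w ^+ 4).
  apply: (L1_le _ _ (L1Z (32 * sigma ^+ 4) iZ)); first exact: measurable_funX.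
  by move=> w; rewrite ger0_norm// exprn_even_ge0.
split => //; apply: le_trans (mean_le iX4 (L1Z _ iZ) XZ) _.
by rewrite meanZ// EZ; lra.
Qed.

(** Integrating 1 + c X^2 <= exp (c X^2), with c = (1 - r^2) / (2 sigma^2), gives
    r (1 + r) E X^2 <= 2 sigma^2 for every r < 1; let r tend to 1. *)
Lemma normal_moment2 : L2 P X /\ mean P (fun w => X w ^+ 2) <= sigma ^+ 2.
Proof.
have iX2 : L1 P (fun w => X w ^+ 2).
  have [iX4 _] := normal_moment4.
  apply: (L1_le _ _ (L1D (L1_cst P 1) iX4)); first exact: measurable_funX.
  move=> w; rewrite ger0_norm ?sqr_ge0//=.
  have := sqr_ge0 (X w ^+ 2 - 1); rewrite (exprM _ 2 2).
  have := sqr_ge0 (X w); nra.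
split => //; set m := mean _ _.
have bnd r : 0 < r < 1 -> m * (r * (1 + r)) <= 2 * sigma ^+ 2.
  move=> /andP[r0 r1]; have [iZ EZ] := normal_exp_quadratic r0.
  pose Z w := expR ((1 - r ^+ 2) * X w ^+ 2 / (2 * sigma ^+ 2)).
  rewrite -/Z in iZ EZ.
  set c := (1 - r ^+ 2) / (2 * sigma ^+ 2).
  have := @mean_le _ _ _ P (fun w => 1 + c * X w ^+ 2) Z.
  rewrite meanD ?meanZ//; [|exact: L1_cst|exact: L1Z].
  rewrite (mean_cst P 1) EZ -/m => /(_ (L1D (L1_cst P 1) (L1Z c iX2)) iZ).
  have : forall w, 1 + c * X w ^+ 2 <= Z w.
    by move=> w; rewrite (le_trans (expR_ge1Dx _))// /Z /c mulrAC.
  move=> H /(_ H) {H}.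
  have s20 : 0 < sigma ^+ 2 by rewrite exprn_gt0.
  rewrite -lerBrDl -(ler_pM2r (_ : 0 < 2 * sigma ^+ 2 * r)); last first.
    by rewrite !mulr_gt0.
  have -> : c * m * (2 * sigma ^+ 2 * r) = (1 - r) * (m * (r * (1 + r))).
    by rewrite /c; field; rewrite gt_eqF.
  have -> : (r^-1 - 1) * (2 * sigma ^+ 2 * r) = (1 - r) * (2 * sigma ^+ 2).
    by field; rewrite gt_eqF.
  by rewrite ler_pM2l ?subr_gt0.
rewrite leNgt; apply/negP => ms.
have s20 : 0 < sigma ^+ 2 by rewrite exprn_gt0.
have mp : 0 < m by exact: lt_trans ms.
(* With r = 1 - e the bound reads m (2 - 3 e + e^2) <= 2 sigma^2, which fails for
   this e as soon as m > sigma^2. *)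
set e := (m - sigma ^+ 2) / (2 * m).
have e0 : 0 < e by rewrite divr_gt0 ?subr_gt0 ?mulr_gt0.
have e1 : e < 1 by rewrite ltr_pdivrMr ?mulr_gt0//; lra.
have em : m * e = (m - sigma ^+ 2) / 2 by rewrite /e; field; rewrite gt_eqF.
have := bnd (1 - e); rewrite gtrBl e0 subr_gt0 e1 => /(_ isT).
have mee : 0 <= m * e * e.
  by apply: mulr_ge0; [apply: mulr_ge0|]; exact: ltW.
have -> : m * ((1 - e) * (1 + (1 - e))) = 2 * m - 3 * (m * e) + m * e * e.
  by ring.
rewrite em; rewrite em in mee; lra.
Qed.

(** Integrating 1 + t X <= exp (t X) gives t m <= exp (t^2 sigma^2 / 2) - 1 for
    the mean m and every t. The right-hand side is quadratic in t near 0, so the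
    linear left-hand side forces m = 0. *)
Lemma normal_mean : mean P X = 0.
Proof.
have [L2X _] := normal_moment2; have iX := L2_L1 L2X.
set m := mean P X; apply/eqP; apply/negP => /negP m0.
have bnd t : 1 + t * m <= expR (t ^+ 2 * sigma ^+ 2 / 2).
  have [iZ <-] := normal_exp_linear t.
  rewrite -meanZ// -{1}(mean_cst P 1) -meanD//; [|exact: L1_cst|exact: L1Z].
  apply: mean_le => //; first by apply: L1D; [exact: L1_cst|exact: L1Z].
  by move=> w; exact: expR_ge1Dx.
have s20 : 0 < sigma ^+ 2 by rewrite exprn_gt0.
(* D is large enough that t = m / D makes the exponent u at most 1 / 2 and that
   D > sigma^2, which contradicts m^2 / D <= 2 u = m^2 sigma^2 / D^2. *)
set D := 1 + sigma ^+ 2 + m ^+ 2 * sigma ^+ 2.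
have D0 : 1 + sigma ^+ 2 <= D by rewrite /D lerDl; apply: mulr_ge0; exact: sqr_ge0.
have Dp : 0 < D by apply: lt_le_trans D0; lra.
have m20 : 0 < m ^+ 2 by rewrite exprn_even_gt0.
set u := (m / D) ^+ 2 * sigma ^+ 2 / 2.
have uE : u * (2 * D ^+ 2) = m ^+ 2 * sigma ^+ 2.
  by rewrite /u; field; rewrite gt_eqF.
have u0 : 0 <= u.
  by rewrite /u; apply: divr_ge0 => //; apply: mulr_ge0; exact: sqr_ge0.
have u1 : u <= 2^-1.
  rewrite -(ler_pM2r (_ : 0 < 2 * D ^+ 2)) ?mulr_gt0 ?exprn_gt0// uE.
  have : m ^+ 2 * sigma ^+ 2 <= D by rewrite /D; lra.
  have : 1 <= D by lra.
  nra.
have := bnd (m / D); rewrite -/u => b1.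
have b2 : expR u * (1 - u) <= 1.
  have := expR_ge1Dx (- u); rewrite expRN => b.
  by rewrite -ler_pdivlMl ?expR_gt0// mulr1.
have b3 : m / D * m <= 2 * u.
  have : (1 + m / D * m) * (1 - u) <= 1.
    by apply: le_trans b2; rewrite ler_wpM2r//; lra.
  have : 0 <= m / D * m by rewrite mulrAC -expr2 divr_ge0 ?ltW.
  nra.
move: b3; rewrite -(ler_pM2r (_ : 0 < D ^+ 2)) ?exprn_gt0//.
have -> : 2 * u * D ^+ 2 = u * (2 * D ^+ 2) by ring.
rewrite uE (_ : _ * D ^+ 2 = m ^+ 2 * D); last by field; rewrite gt_eqF.
rewrite ler_pM2l//; lra.
Qed.

End NormalMoments.

(** * Moments of the Poisson law *)

Section PoissonSeries.
Context {R : realType}.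
Variables (mu : R) (mu0 : 0 < mu).
Implicit Type f : nat -> R.

(** The mean of [f] under the Poisson law with parameter [mu]. *)
Definition poisson_sum f : \bar R := (\sum_(k <oo) (f k * poisson_pmf mu k)%:E)%E.

Lemma poisson_sum1 : poisson_sum (cst 1) = 1%E.
Proof.
have := @probability_setT _ _ _ (poisson_prob mu 0%N).
rewrite /= /poisson_prob mu0 -nneseries_esumT; last first.
  by move=> k; rewrite lee_fin poisson_pmf_ge0.
by rewrite /poisson_sum; under [in X in _ -> X]eq_eseriesr do rewrite mul1r.
Qed.

(** From (k + 1) p_(k + 1) = mu p_k for the weights p_k; both moments are
    instances of this shift. *)
Lemma poisson_sum_shift f : (forall k, 0 <= f k) ->
  poisson_sum (fun k => k%:R * f k) = (mu%:E * poisson_sum (fun k => f k.+1))%E.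
Proof.
move=> f0; rewrite /poisson_sum -nneseriesZl; last first.
  by move=> k _; rewrite lee_fin mulr_ge0 ?poisson_pmf_ge0.
rewrite nneseries_recl//; last first.
  by move=> k _; rewrite lee_fin !mulr_ge0 ?poisson_pmf_ge0.
rewrite !mul0r add0e -nneseries_addn; last first.
  by move=> k; rewrite lee_fin !mulr_ge0 ?poisson_pmf_ge0.
apply: eq_eseriesr => k _; rewrite addn1 -EFinM; congr EFin.
rewrite /poisson_pmf mu0 factS natrM exprS.
have : k.+1%:R != 0 :> R by rewrite pnatr_eq0.
have : k`!%:R != 0 :> R by rewrite pnatr_eq0 -lt0n fact_gt0.
by move: k`!%:R k.+1%:R => a b a0 b0; field; rewrite a0 b0.
Qed.

Lemma poisson_sum_mean : poisson_sum (fun k => k%:R) = mu%:E.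
Proof.
have := @poisson_sum_shift (cst 1) (fun=> ler01).
by under eq_fun do rewrite mulr1; rewrite poisson_sum1 mule1.
Qed.

Lemma poisson_sum_sqr : poisson_sum (fun k => k%:R ^+ 2) = (mu + mu ^+ 2)%:E.
Proof.
have := @poisson_sum_shift (fun k => k%:R) (fun k => ler0n _ k).
under eq_fun do rewrite -expr2; move=> ->.
rewrite (_ : poisson_sum _ = (mu + 1)%:E) -?EFinM; first by congr EFin; ring.
rewrite EFinD -poisson_sum1 -poisson_sum_mean /poisson_sum -nneseriesD.
- apply: eq_eseriesr => k _; rewrite -EFinD; congr EFin.
  by rewrite -natr1 /=; ring.
- by move=> k _ _; rewrite lee_fin mulr_ge0 ?poisson_pmf_ge0.
- by move=> k _ _; rewrite lee_fin mulr_ge0 ?poisson_pmf_ge0.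
Qed.

End PoissonSeries.

Section PoissonMoments.
Context {dT : measure_display} {T : measurableType dT} {R : realType}.
Variable P : probability T R.
Variables (X : T -> R) (mu : R).
Hypotheses (mX : measurable_fun setT X) (mu0 : 0 < mu).
Hypothesis lawX : forall k : nat, P [set w | X w = k%:R] = (poisson_pmf mu k)%:E.

(** The law is prescribed only on the natural numbers, but the prescribed weights
    sum to 1, so [X] takes values elsewhere only on a null set. *)
Lemma integral_poisson (f : R -> R) : measurable_fun setT f ->
  (forall x, 0 <= f x) ->
  (\int[P]_w (f (X w))%:E = poisson_sum mu (fun k => f k%:R))%E.
Proof.
move=> mf f0.
pose A k : set T := [set w | X w = k%:R].
have mA k : measurable (A k).
  by rewrite -[A k]setTI; exact: (mX measurableT (measurable_set1 k%:R)).
have tA : trivIset setT A.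
  apply/trivIsetP => i j _ _ ij; apply/seteqP; split => // w [/= Xi].
  rewrite /A/= Xi => /eqP.
  by rewrite eqr_nat (negbTE ij).
have mUA : measurable (\bigcup_k A k) by exact: bigcupT_measurable.
have PUA : P (\bigcup_k A k) = 1%E.
  rewrite measure_semi_bigcup// -(poisson_sum1 mu0).
  by apply: eq_eseriesr => k _; rewrite /= mul1r; exact: lawX.
have mfX D : measurable_fun D (EFin \o (f \o X)).
  by apply: measurable_funTS; apply/measurable_EFinP; exact: measurableT_comp.
rewrite (@ge0_negligible_integral _ _ _ _ _ (~` \bigcup_k A k))//; last 3 first.
- exact: measurableC.
- by move=> w _; rewrite lee_fin.
- transitivity (1 - P (\bigcup_k A k))%E; first exact: probability_setC.
  by rewrite PUA subee.
rewrite setTD setCK ge0_integral_bigcup//; last by move=> w _; rewrite lee_fin.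
apply: eq_eseriesr => k _; rewrite EFinM -lawX -(integral_cst P (mA k)).
by apply: eq_integral => w /[!inE] /= ->.
Qed.

Lemma poisson_moment2 : L2 P X /\ mean P (fun w => X w ^+ 2) = mu + mu ^+ 2.
Proof.
have E : (\int[P]_w (X w ^+ 2)%:E = (mu + mu ^+ 2)%:E)%E.
  rewrite (@integral_poisson (fun x => x ^+ 2)) ?poisson_sum_sqr//.
  by move=> x; exact: sqr_ge0.
split; last by rewrite /mean /Rintegral E.
split=> //; apply/integrableP; split.
  by apply/measurable_EFinP; exact: measurable_funX.
by under eq_integral do rewrite /= ger0_norm ?sqr_ge0//; rewrite E ltry.
Qed.

(** Nonnegative functions can be integrated term by term; this applies to |X| and
    to |X| - X, and the latter vanishes at the natural numbers. *)
Lemma poisson_mean : mean P X = mu.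
Proof.
have [X2 _] := poisson_moment2; have iX := L2_L1 X2.
have E : mean P (fun w => `|X w|) = mu.
  rewrite /mean /Rintegral (@integral_poisson (fun x => `|x|))//.
  under [X in fine (_ X)]eq_fun do rewrite ger0_norm ?ler0n//.
  by rewrite poisson_sum_mean.
have F : mean P (fun w => `|X w| - X w) = 0.
  rewrite /mean /Rintegral (@integral_poisson (fun x => `|x| - x)).
  - rewrite /poisson_sum eseries0// => k _ _.
    by rewrite ger0_norm ?ler0n// subrr mul0r.
  - by apply: measurable_funB.
  - by move=> x; rewrite subr_ge0 ler_norm.
by move: F; rewrite meanB//; [rewrite E; lra|exact: L1_norm].
Qed.

End PoissonMoments.

(** * Independence from the past *)

Section IndependenceTransfer.
Context {dT : measure_display} {T : measurableType dT} {R : realType}.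
Variable P : probability T R.

Lemma independent_compr (X Y : T -> R) (f : R -> R) : measurable_fun setT f ->
  independent P X Y -> independent P X (fun w => f (Y w)).
Proof.
move=> mf indXY A B mA mB; apply: (indXY A (f @^-1` B)) => //.
by rewrite -[_ @^-1` _]setTI; exact: mf.
Qed.

Lemma independent_of_comp {U : Type} (G : set (set T)) (S : set (set U))
    (xi : T -> U) (phi : U -> R) (Z : T -> R) : sigma_algebra setT G ->
  independent_of P G S xi -> (forall B, measurable B -> S (phi @^-1` B)) ->
  adapted G Z -> independent P Z (phi \o xi).
Proof.
move=> sG ind mphi /(adaptedP sG) aZ A B mA mB.
rewrite (_ : (phi \o xi) @^-1` B = xi @^-1` (phi @^-1` B))//.
by apply: ind; [exact: aZ|exact: mphi].
Qed.

Lemma L1_mul_sqr (Z X : T -> R) : independent P Z X -> L1 P Z -> L2 P X ->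
  L1 P (fun w => Z w * X w ^+ 2).
Proof.
move=> indZX iZ [_ iX].
have indZX2 : independent P Z (fun w => X w ^+ 2).
  by apply: (independent_compr (f := fun x => x ^+ 2) _ indZX); exact: measurable_funX.
exact: (independent_meanM indZX2 iZ iX).1.
Qed.

(** This yields integrability of a product of two increments that are not known to
    be independent of each other: |x y| <= x^2 + y^2. *)
Lemma L1_mul_mul (Z X Y : T -> R) : L1 P Z ->
  measurable_fun setT X -> measurable_fun setT Y ->
  L1 P (fun w => Z w * X w ^+ 2) -> L1 P (fun w => Z w * Y w ^+ 2) ->
  L1 P (fun w => Z w * (X w * Y w)).
Proof.
move=> iZ mX mY iX iY.
apply: (L1_le _ _ (L1D (L1_norm iX) (L1_norm iY))).
  by apply: measurable_funM; [exact: L1_measurable iZ|exact: measurable_funM].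
move=> w; rewrite !normrM -mulrDr ler_wpM2l//.
by have := normr_ge0 (X w); have := normr_ge0 (Y w); nra.
Qed.

End IndependenceTransfer.

(** The bound on the product of a Brownian increment [x] and a Poisson increment
    [y]. It rests on the gap of [y] between 0 and 1: if y <= J x then J x >= 1,
    so extra powers of J x may be inserted. Over a time r both y^2 and x^4 / r have
    means of order r, and the weight 1 / J makes the first contribution small. *)
Lemma mul_le_sqr_D_expr4 {R : realFieldType} (J x y : R) : 0 < J -> 0 <= x ->
  y = 0 \/ 1 <= y -> x * y <= y ^+ 2 / J + J ^+ 3 * x ^+ 4.
Proof.
move=> J0 x0 [->|y1].
  rewrite mulr0 expr0n/= mul0r add0r.
  by apply: mulr_ge0; apply: exprn_ge0 => //; exact: ltW.
have [yJx|Jxy] := leP y (J * x); last first.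
  apply: (@le_trans _ _ (y ^+ 2 / J)).
    rewrite ler_pdivlMr//; apply: (@le_trans _ _ (y * (J * x))).
      by rewrite le_eqVlt; apply/orP; left; apply/eqP; ring.
    have y0 : 0 <= y by lra.
    by rewrite expr2 ler_wpM2l// ltW.
  by rewrite lerDl; apply: mulr_ge0; apply: exprn_ge0 => //; exact: ltW.
apply: (@le_trans _ _ (J ^+ 3 * x ^+ 4)); last first.
  by rewrite lerDr divr_ge0 ?sqr_ge0 ?ltW.
have Jx1 : 1 <= J * x by lra.
apply: (@le_trans _ _ (x * (J * x))); first by rewrite ler_wpM2l.
rewrite (_ : J ^+ 3 * _ = x * (J * x) * (J * x) ^+ 2); last by ring.
rewrite ler_peMr//; first by rewrite mulr_ge0//; lra.
by rewrite expr_ge1//; lra.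
Qed.

(** * Second moment of a sum of orthogonal noise terms *)

Section Noise.
Context {dT : measure_display} {T : measurableType dT} {R : realType}.
Variable P : probability T R.
Variable G : set (set T).
Variables (K : finType) (xi : K -> T -> R) (tau : K -> R).
Local Notation E := (mean P).
Implicit Types Z : T -> R.
Hypothesis xi_L2 : forall k, L2 P (xi k).
Hypothesis xi_indep : forall k Z, adapted G Z -> independent P Z (xi k).
Hypothesis xi_mean : forall k, E (xi k) = 0.
Hypothesis xi_var : forall k, E (fun w => xi k w ^+ 2) <= tau k.
Hypothesis xi_orth : forall k l Z, k != l -> adapted G Z -> L1 P Z ->
  E (fun w => Z w * (xi k w * xi l w)) = 0.

Lemma noise_term (c : T -> R) k : adapted G c -> L2 P c ->
  L2 P (fun w => c w * xi k w) /\
  E (fun w => (c w * xi k w) ^+ 2) <= tau k * E (fun w => c w ^+ 2).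
Proof.
move=> ac ic.
have ac2 : adapted G (fun w => c w ^+ 2) by exact: measurable_funX.
have ind2 : independent P (fun w => c w ^+ 2) (fun w => xi k w ^+ 2).
  apply: (independent_compr (f := fun x => x ^+ 2)); first exact: measurable_funX.
  exact: xi_indep.
have [i2 E2] := independent_meanM ind2 ic.2 (xi_L2 k).2.
split.
  split; first by apply: measurable_funM; [exact: ic.1|exact: (xi_L2 k).1].
  by under eq_fun do rewrite exprMn.
under eq_fun do rewrite exprMn.
rewrite E2 mulrC ler_wpM2r//; apply: mean_ge0 => w; exact: sqr_ge0.
Qed.

(** The centred increments are orthogonal to [b] because they are independent of
    the past, and to one another by [xi_orth]; Pythagoras then splits the second
    moment, and independence factors each term. *)
Lemma noise_second_moment (b : T -> R) (c : K -> T -> R) :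
  adapted G b -> L2 P b -> (forall k, adapted G (c k)) -> (forall k, L2 P (c k)) ->
  L2 P (fun w => b w + \sum_k c k w * xi k w) /\
  E (fun w => (b w + \sum_k c k w * xi k w) ^+ 2) <=
  E (fun w => b w ^+ 2) + \sum_k tau k * E (fun w => c k w ^+ 2).
Proof.
move=> ab ib ac ic.
have iX k : L2 P (fun w => c k w * xi k w) by exact: (noise_term k (ac k) (ic k)).1.
have iS : L2 P (fun w => \sum_k c k w * xi k w) by exact: L2_sum.
split; first exact: L2D.
have bS : E (fun w => b w * \sum_k c k w * xi k w) = 0.
  under eq_fun do rewrite mulr_sumr.
  rewrite mean_sum; last by move=> k; exact: L2M.
  apply: big1 => k _.
  have abc : adapted G (fun w => b w * c k w).
    by apply: measurable_funM; [exact: ab|exact: ac].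
  have [_] := independent_meanM (xi_indep k abc) (L2M ib (ic k)) (L2_L1 (xi_L2 k)).
  rewrite xi_mean mulr0 => <-.
  by congr mean; apply/funext => w; rewrite mulrA.
have -> : E (fun w => (b w + \sum_k c k w * xi k w) ^+ 2) =
    E (fun w => b w ^+ 2) + E (fun w => (\sum_k c k w * xi k w) ^+ 2).
  pose S w := \sum_k c k w * xi k w.
  transitivity (E (fun w => b w ^+ 2 + S w ^+ 2 + 2 * (b w * S w))).
    by congr mean; apply/funext => w; rewrite /S; ring.
  rewrite meanD; [|exact: (L1D ib.2 iS.2)|exact: (L1Z 2 (L2M ib iS))].
  rewrite meanD; [|exact: ib.2|exact: iS.2].
  by rewrite (meanZ _ (L2M ib iS)) [X in 2 * X]bS mulr0 addr0.
rewrite lerD2l (pythagoras iX).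
  by apply: ler_sum => k _; exact: (noise_term k (ac k) (ic k)).2.
move=> k l kl.
rewrite -[RHS](@xi_orth k l (fun w => c k w * c l w))//.
- by congr mean; apply/funext => w; ring.
- by apply: measurable_funM; exact: ac.
- exact: L2M.
Qed.

End Noise.

(** * The Euclidean norm *)

Section Euclidean.
Context {R : realType}.

Lemma enorm_ge0 m n (A : 'M[R]_(m, n)) : 0 <= enorm A.
Proof. exact: sqrtr_ge0. Qed.

Lemma enorm_sqr m n (A : 'M[R]_(m, n)) :
  enorm A ^+ 2 = \sum_i \sum_j A i j ^+ 2.
Proof.
by rewrite sqr_sqrtr//; apply: sumr_ge0 => i _; apply: sumr_ge0 => j _; exact: sqr_ge0.
Qed.

Lemma enorm0 m n : enorm (0 : 'M[R]_(m, n)) = 0.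
Proof.
apply/eqP; rewrite -sqrf_eq0 enorm_sqr big1// => i _; rewrite big1// => j _.
by rewrite mxE expr0n.
Qed.

Lemma entry_sqr_le m n (A : 'M[R]_(m, n)) i j : A i j ^+ 2 <= enorm A ^+ 2.
Proof.
rewrite enorm_sqr (bigD1 i)//= (bigD1 j)//= -addrA lerDl addr_ge0//.
  by apply: sumr_ge0 => k _; exact: sqr_ge0.
by apply: sumr_ge0 => k _; apply: sumr_ge0 => l _; exact: sqr_ge0.
Qed.

Lemma entry_le_enorm m n (A : 'M[R]_(m, n)) i j : `|A i j| <= enorm A.
Proof.
by rewrite -(ler_pXn2r (n := 2)) ?nnegrE ?enorm_ge0// real_normK ?num_real// entry_sqr_le.
Qed.

Lemma enorm_cV n (x : 'cV[R]_n) : enorm x ^+ 2 = \sum_i x i 0 ^+ 2.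
Proof. by rewrite enorm_sqr; apply: eq_bigr => i _; rewrite big_ord1. Qed.

Lemma dotvv n (x : 'cV[R]_n) : dotv x x = enorm x ^+ 2.
Proof. by rewrite enorm_cV; apply: eq_bigr => i _; rewrite expr2. Qed.

Lemma dotvC n (x y : 'cV[R]_n) : dotv x y = dotv y x.
Proof. by apply: eq_bigr => i _; rewrite mulrC. Qed.

Lemma dotvDr n (x y z : 'cV[R]_n) : dotv x (y + z) = dotv x y + dotv x z.
Proof. by rewrite -big_split; apply: eq_bigr => i _; rewrite mxE mulrDr. Qed.

Lemma dotvZr n a (x y : 'cV[R]_n) : dotv x (a *: y) = a * dotv x y.
Proof. by rewrite mulr_sumr; apply: eq_bigr => i _; rewrite mxE mulrCA. Qed.

Lemma enormD_sqr n (x y : 'cV[R]_n) :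
  enorm (x + y) ^+ 2 = enorm x ^+ 2 + 2 * dotv x y + enorm y ^+ 2.
Proof.
rewrite -!dotvv dotvDr dotvC dotvDr [dotv (x + y) y]dotvC dotvDr (dotvC y x); ring.
Qed.

Lemma enormZ_sqr n a (x : 'cV[R]_n) : enorm (a *: x) ^+ 2 = a ^+ 2 * enorm x ^+ 2.
Proof. by rewrite -!dotvv dotvZr dotvC dotvZr mulrA expr2. Qed.

(** Expand the square of the vector |y| x - |x| y. *)
Lemma cauchy_schwarz n (x y : 'cV[R]_n) : dotv x y <= enorm x * enorm y.
Proof.
have [x0|x0] := eqVneq (enorm x) 0.
  rewrite x0 mul0r /dotv big1// => i _.
  have := entry_le_enorm x i 0; rewrite x0 normr_le0 => /eqP ->.
  by rewrite mul0r.
have xp : 0 < enorm x by rewrite lt_def x0 enorm_ge0.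
have := sqr_ge0 (enorm (enorm y *: x + (- enorm x) *: y)).
rewrite enormD_sqr !enormZ_sqr dotvZr (dotvC (_ *: x)) dotvZr (dotvC y).
rewrite sqrrN => h.
have [y0|y0] := eqVneq (enorm y) 0.
  rewrite y0 mulr0 /dotv big1// => i _.
  have := entry_le_enorm y i 0; rewrite y0 normr_le0 => /eqP ->.
  by rewrite mulr0.
have yp : 0 < enorm y by rewrite lt_def y0 enorm_ge0.
rewrite -subr_ge0 -(pmulr_rge0 _ (_ : 0 < 2 * (enorm x * enorm y))).
  by apply: le_trans h _; rewrite le_eqVlt; apply/orP; left; apply/eqP; ring.
by rewrite !mulr_gt0.
Qed.

Lemma enormD n (x y : 'cV[R]_n) : enorm (x + y) <= enorm x + enorm y.
Proof.
rewrite -(ler_pXn2r (n := 2)) ?nnegrE ?addr_ge0 ?enorm_ge0//.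
by rewrite enormD_sqr; have := cauchy_schwarz x y; lra.
Qed.

Lemma enormZ n a (x : 'cV[R]_n) : 0 <= a -> enorm (a *: x) = a * enorm x.
Proof.
move=> a0; apply/eqP; rewrite -(eqrXn2 (n := 2)) ?enorm_ge0 ?mulr_ge0 ?enorm_ge0//.
by rewrite enormZ_sqr exprMn.
Qed.

End Euclidean.

(** * Contraction by the tamed drift *)

Section Drift.
Context {R : realType} {d : nat}.

(** Put s = 1 + D |v|. The terms containing the tamed drift add up to
    (D / s) (2 <x, v> + 2 D <p, v> + (D / s) |v|^2), and the two conditions on D
    make the bracket nonpositive, in the regimes |x| <= 1 and |x| >= 1. The
    remaining terms are those of the explicit Euler step with drift [p]. *)
Lemma tamed_drift_bound (x p v : 'cV[R]_d) (A kappa beta betabar a D : R) :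
  0 < A -> 0 < beta -> 0 < betabar -> 1 < a -> 0 < D ->
  enorm p <= A * enorm x -> dotv x p <= kappa * enorm x ^+ 2 ->
  dotv x v <= - beta * enorm x `^ (a + 1) -> enorm v <= betabar * enorm x `^ a ->
  D * ((2 * A + betabar) * betabar) <= 2 * beta ->
  D * (2 * A * betabar) <= 2 * beta - betabar ->
  enorm (x + D *: p + (D / (1 + D * enorm v)) *: v) ^+ 2 <=
  (1 + 2 * D * kappa + D ^+ 2 * A ^+ 2) * enorm x ^+ 2.
Proof.
move=> A0 b0 bb0 a1 D0 pA xp xv vb D1 D2.
set X := enorm x; set V := enorm v; set s := 1 + D * V.
have X0 : 0 <= X := enorm_ge0 x.
have V0 : 0 <= V := enorm_ge0 v.
have s1 : 1 <= s by rewrite /s lerDl mulr_ge0// ltW.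
have s0 : 0 < s by lra.
have XaE : X `^ (a + 1) = X `^ a * X.
  have [->|Xn0] := eqVneq X 0; last by rewrite powRD ?Xn0 ?implybT// powRr1.
  by rewrite mulr0 powR0// gt_eqF//; lra.
rewrite -/X XaE in xv; rewrite -/X -/V in vb.
have Xa0 : 0 <= X `^ a by exact: powR_ge0.
set e := X `^ a * X in xv *; have e0 : 0 <= e by rewrite mulr_ge0.
have pv : dotv p v <= A * betabar * e.
  apply: le_trans (cauchy_schwarz p v) _.
  rewrite (_ : A * betabar * e = (A * X) * (betabar * X `^ a)); last by rewrite /e; ring.
  by apply: ler_pM => //; exact: enorm_ge0.
(* For X <= 1 the taming is discarded (s >= 1) and X^(2a) <= X^(a + 1); for X >= 1
   the taming gives D V / s <= 1 and X^a <= X^(a + 1). *)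
have DsV : D / s * V ^+ 2 <= 2 * beta * e - 2 * D * A * betabar * e.
  have [X1|X1] := leP X 1.
    apply: (@le_trans _ _ (D * (betabar ^+ 2 * e))).
      rewrite -mulrA ler_pM2l// mulrC ler_pdivrMr//.
      apply: (@le_trans _ _ (betabar ^+ 2 * e)); last first.
        by rewrite ler_peMr// mulr_ge0// sqr_ge0.
      apply: (@le_trans _ _ ((betabar * X `^ a) ^+ 2)).
        by rewrite ler_pXn2r ?nnegrE// mulr_ge0// ltW.
      rewrite exprMn ler_wpM2l ?sqr_ge0// expr2 /e ler_wpM2l//.
      have [->|Xn0] := eqVneq X 0; first by rewrite powR0// gt_eqF//; lra.
      apply: ge1r_powR; last exact: ltW.
      by rewrite lt_def Xn0 X0.
    have := ler_wpM2r e0 D1; lra.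
  apply: (@le_trans _ _ V).
    rewrite mulrAC ler_pdivrMr// /s; nra.
  apply: (@le_trans _ _ (betabar * e)).
    apply: le_trans vb _; rewrite ler_pM2l// /e ler_peMr//.
    exact: ltW.
  have := ler_wpM2r e0 D2; lra.
have Ds0 : 0 < D / s by exact: divr_gt0.
rewrite enormD_sqr enormD_sqr !enormZ_sqr !dotvZr -/X -/V.
rewrite [dotv (x + _) v]dotvC dotvDr dotvZr (dotvC v x) (dotvC v p).
have p2 : enorm p ^+ 2 <= A ^+ 2 * X ^+ 2.
  by rewrite -exprMn ler_pXn2r ?nnegrE ?enorm_ge0// mulr_ge0// ltW.
have r1 : D / s * (2 * (dotv x v + D * dotv p v) + D / s * V ^+ 2) <= 0.
  rewrite pmulr_rle0//; have := ler_wpM2l (ltW D0) pv; lra.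
have r2 := ler_wpM2l (sqr_ge0 D) p2.
have r3 := ler_wpM2l (ltW D0) xp.
rewrite -/X in r3.
apply: (@le_trans _ _ (X ^+ 2 + 2 * (D * dotv x p) + D ^+ 2 * enorm p ^+ 2 +
  D / s * (2 * (dotv x v + D * dotv p v) + D / s * V ^+ 2))).
  by rewrite le_eqVlt; apply/orP; left; apply/eqP; ring.
lra.
Qed.

End Drift.

(** * Brownian increments *)

Section Brownian.
Context {dT : measure_display} {T : measurableType dT} {R : realType}.
Variable P : probability T R.
Variable F : R -> set (set T).
Hypothesis HF : filtration F.
Variables (m : nat) (W : R -> T -> 'cV[R]_m).
Hypothesis HW : brownian_motion P F W.
Implicit Types (s t : R) (Z : T -> R) (i j : 'I_m).

Lemma brownian_adapted t i : 0 <= t -> adapted (F t) (fun w => W t w i 0).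
Proof.
move=> t0; apply: adapted_coord; first exact: (filtration_sigma HF).
exact: bm_adapted HW t t0.
Qed.

Let mW t i : 0 <= t -> measurable_fun setT (fun w => W t w i 0).
Proof. by move=> t0; exact: (filtration_measurable HF t0 (brownian_adapted i t0)). Qed.

Let mdW s t i : 0 <= s -> s < t ->
  measurable_fun setT (fun w => W t w i 0 - W s w i 0).
Proof. by move=> s0 st; apply: measurable_funB; apply: mW => //; lra. Qed.

Lemma brownian_coord_law s t i : 0 <= s -> s < t -> forall B, measurable B ->
  P ((fun w => W t w i 0 - W s w i 0) @^-1` B) = normal_prob 0 (Num.sqrt (t - s)) B.
Proof.
move=> s0 st B mB.
pose C k := if k == i then B else setT.
have mC k : measurable (C k) by rewrite /C; case: ifP.
rewrite (_ : _ @^-1` _ = [set w | forall k, C k ((W t w - W s w) k 0)]).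
  rewrite (bm_law HW s0 st mC) (bigD1 i)//= big1 ?mule1 /C ?eqxx// => k ki.
  by rewrite (negbTE ki); exact: probability_setT.
apply/seteqP; split => w /=.
  by move=> Bw k; rewrite /C !mxE; case: eqP => // ->.
by move=> /(_ i); rewrite /C eqxx !mxE.
Qed.

Lemma brownian_coord_independent s t i j : 0 <= s -> s < t -> i != j ->
  independent P (fun w => W t w i 0 - W s w i 0) (fun w => W t w j 0 - W s w j 0).
Proof.
move=> s0 st ij A B mA mB; rewrite !brownian_coord_law//.
pose C k := if k == i then A else if k == j then B else setT.
have mC k : measurable (C k) by rewrite /C; case: ifP => // _; case: ifP.
rewrite (_ : _ `&` _ = [set w | forall k, C k ((W t w - W s w) k 0)]).
  rewrite (bm_law HW s0 st mC) (bigD1 i)//= (bigD1 j)/=; last by rewrite eq_sym.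
  rewrite big1 ?mule1 /C ?eqxx//; first by rewrite eq_sym (negbTE ij).
  move=> k /andP[ki kj].
  by rewrite (negbTE ki) (negbTE kj); exact: probability_setT.
apply/seteqP; split => w /=.
  move=> [Aw Bw] k; rewrite /C !mxE; case: eqP => [->//|_].
  by case: eqP => // ->.
move=> h; split; first by have := h i; rewrite /C eqxx !mxE.
by have := h j; rewrite /C eqxx eq_sym (negbTE ij) !mxE.
Qed.

Lemma brownian_independent_past s t Z (phi : 'cV[R]_m -> R) : 0 <= s -> s < t ->
  continuous phi -> adapted (F s) Z ->
  independent P Z (fun w => phi (W t w - W s w)).
Proof.
move=> s0 st cphi aZ.
apply: (independent_of_comp (filtration_sigma HF s0) (bm_indep HW s0 st) _ aZ) => B mB.
by have := continuous_borel cphi measurableT mB; rewrite setTI.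
Qed.

Lemma brownian_coord_independent_past s t i Z : 0 <= s -> s < t -> adapted (F s) Z ->
  independent P Z (fun w => W t w i 0 - W s w i 0).
Proof.
move=> s0 st aZ.
have := @brownian_independent_past s t Z (fun x => x i 0) s0 st
  (@coord_continuous _ _ _ i 0) aZ.
by under eq_fun do rewrite !mxE.
Qed.

Let sd_gt0 s t : s < t -> 0 < Num.sqrt (t - s).
Proof. by move=> st; rewrite sqrtr_gt0 subr_gt0. Qed.

Lemma brownian_L2 s t i : 0 <= s -> s < t ->
  L2 P (fun w => W t w i 0 - W s w i 0).
Proof.
move=> s0 st.
exact: (normal_moment2 (mdW i s0 st) (sd_gt0 st) (brownian_coord_law i s0 st)).1.
Qed.

Lemma brownian_var s t i : 0 <= s -> s < t ->
  mean P (fun w => (W t w i 0 - W s w i 0) ^+ 2) <= t - s.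
Proof.
move=> s0 st.
have := (normal_moment2 (mdW i s0 st) (sd_gt0 st) (brownian_coord_law i s0 st)).2.
by rewrite sqr_sqrtr// subr_ge0 ltW.
Qed.

Lemma brownian_mean s t i : 0 <= s -> s < t ->
  mean P (fun w => W t w i 0 - W s w i 0) = 0.
Proof.
move=> s0 st.
exact: (normal_mean (mdW i s0 st) (sd_gt0 st) (brownian_coord_law i s0 st)).
Qed.

Lemma brownian_moment4 s t i : 0 <= s -> s < t ->
  L1 P (fun w => (W t w i 0 - W s w i 0) ^+ 4) /\
  mean P (fun w => (W t w i 0 - W s w i 0) ^+ 4) <= 64 * (t - s) ^+ 2.
Proof.
move=> s0 st.
have [i4 E4] := normal_moment4 (mdW i s0 st) (sd_gt0 st) (brownian_coord_law i s0 st).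
split => //; move: E4.
by rewrite (exprM _ 2 2) sqr_sqrtr// subr_ge0 ltW.
Qed.

(** The product of two coordinates of the increment is a continuous function of
    the increment, hence independent of the past as a whole. *)
Lemma brownian_orthogonal s t i j Z : 0 <= s -> s < t -> i != j ->
  adapted (F s) Z -> L1 P Z ->
  mean P (fun w => Z w * ((W t w i 0 - W s w i 0) * (W t w j 0 - W s w j 0))) = 0.
Proof.
move=> s0 st ij aZ iZ.
have indZ : independent P Z
    (fun w => (W t w i 0 - W s w i 0) * (W t w j 0 - W s w j 0)).
  have cphi : continuous (fun x : 'cV[R]_m => x i 0 * x j 0).
    move=> x; apply: (@cvgM _ _ (nbhs x) _ _ _ (x i 0) (x j 0));
      exact: coord_continuous.
  have := brownian_independent_past s0 st cphi aZ.
  by under eq_fun do rewrite !mxE.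
have [iWW EWW] := independent_meanM (brownian_coord_independent s0 st ij)
  (L2_L1 (brownian_L2 i s0 st)) (L2_L1 (brownian_L2 j s0 st)).
by rewrite (independent_meanM indZ iZ iWW).2 EWW brownian_mean// mul0r mulr0.
Qed.

End Brownian.

(** * Poisson increments *)

Section Poisson.
Context {dT : measure_display} {T : measurableType dT} {R : realType}.
Variable P : probability T R.
Variable F : R -> set (set T).
Hypothesis HF : filtration F.
Variables (lambda : R) (N : R -> T -> nat).
Hypotheses (lambda0 : 0 < lambda) (HN : poisson_process P F lambda N).
Implicit Types (s t : R) (Z : T -> R).
Local Notation Nr := (fun t w => (N t w)%:R : R).
Local Notation M := (compensated lambda N).

Lemma poisson_adapted t : 0 <= t -> adapted (F t) (Nr t).
Proof.
move=> t0; apply/(adaptedP (filtration_sigma HF t0)) => B mB.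
exact: (pp_adapted HN t0 (B := [set k : nat | B k%:R])).
Qed.

Let mdN s t : 0 <= s -> s < t -> measurable_fun setT (fun w => Nr t w - Nr s w).
Proof.
move=> s0 st; have t0 : 0 <= t by lra.
by apply: measurable_funB;
  [exact: (filtration_measurable HF t0 (poisson_adapted t0))|
   exact: (filtration_measurable HF s0 (poisson_adapted s0))].
Qed.

Lemma poisson_independent s t Z : 0 <= s -> s < t -> adapted (F s) Z ->
  independent P Z (fun w => Nr t w - Nr s w).
Proof.
move=> s0 st aZ.
apply: (independent_of_comp (phi := id) (filtration_sigma HF s0)
  (pp_indep HN s0 st) _ aZ) => B mB.
by rewrite borelRE.
Qed.

Lemma poisson_increment_law s t : 0 <= s -> s < t -> forall k : nat,
  P [set w | Nr t w - Nr s w = k%:R] = (poisson_pmf (lambda * (t - s)) k)%:E.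
Proof.
move=> s0 st k; rewrite -(pp_law HN s0 st); congr (P _).
apply/seteqP; split => w /=; last by move=> ->; rewrite natrD; ring.
by move=> /eqP; rewrite subr_eq addrC -natrD eqr_nat => /eqP.
Qed.

Let rate_gt0 s t : s < t -> 0 < lambda * (t - s).
Proof. by move=> st; rewrite mulr_gt0// subr_gt0. Qed.

Lemma poisson_L2 s t : 0 <= s -> s < t -> L2 P (fun w => Nr t w - Nr s w).
Proof.
move=> s0 st.
exact: (poisson_moment2 (mdN s0 st) (rate_gt0 st) (poisson_increment_law s0 st)).1.
Qed.

Lemma poisson_increment_moment2 s t : 0 <= s -> s < t ->
  mean P (fun w => (Nr t w - Nr s w) ^+ 2) =
  lambda * (t - s) + (lambda * (t - s)) ^+ 2.
Proof.
move=> s0 st.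
exact: (poisson_moment2 (mdN s0 st) (rate_gt0 st) (poisson_increment_law s0 st)).2.
Qed.

Lemma poisson_increment_mean s t : 0 <= s -> s < t ->
  mean P (fun w => Nr t w - Nr s w) = lambda * (t - s).
Proof.
move=> s0 st.
exact: (poisson_mean (mdN s0 st) (rate_gt0 st) (poisson_increment_law s0 st)).
Qed.

Lemma compensatedB s t w : M t w - M s w = (Nr t w - Nr s w) - lambda * (t - s).
Proof. by rewrite /compensated; ring. Qed.

Lemma compensated_L2 s t : 0 <= s -> s < t -> L2 P (fun w => M t w - M s w).
Proof.
move=> s0 st; under eq_fun do rewrite compensatedB.
by apply: L2D; [exact: poisson_L2|exact: L2_cst].
Qed.

Lemma compensated_mean s t : 0 <= s -> s < t -> mean P (fun w => M t w - M s w) = 0.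
Proof.
move=> s0 st; under eq_fun do rewrite compensatedB.
rewrite meanB; [|exact/L2_L1/poisson_L2|exact: L1_cst].
by rewrite poisson_increment_mean// (mean_cst P) subrr.
Qed.

Lemma compensated_var s t : 0 <= s -> s < t ->
  mean P (fun w => (M t w - M s w) ^+ 2) = lambda * (t - s).
Proof.
move=> s0 st; under eq_fun do rewrite compensatedB.
set mu := lambda * (t - s).
have iN := poisson_L2 s0 st.
transitivity (mean P (fun w => (Nr t w - Nr s w) ^+ 2 +
    (- (2 * mu) * (Nr t w - Nr s w) + mu ^+ 2))).
  by congr mean; apply/funext => w; ring.
rewrite meanD; [|exact: iN.2|apply: L1D; [exact: (L1Z _ (L2_L1 iN))|exact: L1_cst]].
rewrite meanD; [|exact: (L1Z _ (L2_L1 iN))|exact: L1_cst].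
rewrite (meanZ _ (L2_L1 iN)) (mean_cst P).
rewrite poisson_increment_moment2// poisson_increment_mean// -/mu; ring.
Qed.

Lemma compensated_independent s t Z : 0 <= s -> s < t -> adapted (F s) Z ->
  independent P Z (fun w => M t w - M s w).
Proof.
move=> s0 st aZ; under eq_fun do rewrite compensatedB.
apply: (independent_compr (f := fun x => x - lambda * (t - s))).
  exact: measurable_funB.
exact: poisson_independent.
Qed.

Lemma compensated_adapted t : 0 <= t -> adapted (F t) (M t).
Proof. by move=> t0; apply: measurable_funB => //; exact: poisson_adapted. Qed.

End Poisson.

(** * Orthogonality of Brownian and compensated Poisson increments *)

Section Orthogonality.
Context {dT : measure_display} {T : measurableType dT} {R : realType}.
Variable P : probability T R.
Variable F : R -> set (set T).
Hypothesis HF : filtration F.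
Variables (m : nat) (W : R -> T -> 'cV[R]_m) (lambda : R) (N : R -> T -> nat).
Hypotheses (HW : brownian_motion P F W) (lambda0 : 0 < lambda).
Hypothesis HN : poisson_process P F lambda N.
Variable i : 'I_m.
Implicit Types (r s t h J : R) (Z : T -> R).

Local Notation E := (mean P).
Local Notation A t w := (W t w i 0).
Local Notation Nr t w := ((N t w)%:R : R).
Local Notation M := (compensated lambda N).

Let L1_ZAM s r t Z : 0 <= s -> s <= r -> r < t -> adapted (F s) Z -> L1 P Z ->
  L1 P (fun w => Z w * ((A t w - A r w) * (M t w - M r w))).
Proof.
move=> s0 sr rt aZ iZ; have r0 := le_trans s0 sr.
have aZr := filtration_adapted HF s0 sr aZ.
apply: L1_mul_mul => //.
- exact: (brownian_L2 HF HW i r0 rt).1.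
- exact: (compensated_L2 HF lambda0 HN r0 rt).1.
- apply: L1_mul_sqr => //; last exact: (brownian_L2 HF HW i).
  exact: (brownian_coord_independent_past HF HW i).
- apply: L1_mul_sqr => //; last exact: (compensated_L2 HF lambda0 HN).
  exact: (compensated_independent HF HN).
Qed.

(** Expanding the increments from [s] to [t] at [r], a mixed term is a product of a
    variable known at time [r] and a centred increment after [r]. *)
Let orthog_add s r t Z : 0 <= s -> s < r -> r < t -> adapted (F s) Z -> L1 P Z ->
  E (fun w => Z w * ((A t w - A s w) * (M t w - M s w))) =
  E (fun w => Z w * ((A r w - A s w) * (M r w - M s w))) +
  E (fun w => Z w * ((A t w - A r w) * (M t w - M r w))).
Proof.
move=> s0 sr rt aZ iZ; have r0 := le_trans s0 (ltW sr).
have aZr := filtration_adapted HF s0 (ltW sr) aZ.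
have [iZA _] := independent_meanM (brownian_coord_independent_past HF HW i s0 sr aZ)
  iZ (L2_L1 (brownian_L2 HF HW i s0 sr)).
have [iZM _] := independent_meanM (compensated_independent HF HN s0 sr aZ)
  iZ (L2_L1 (compensated_L2 HF lambda0 HN s0 sr)).
have aA : adapted (F r) (fun w => Z w * (A r w - A s w)).
  apply: measurable_funM => //; apply: measurable_funB.
    exact: (brownian_adapted HF HW).
  by apply: (filtration_adapted HF s0 (ltW sr)); exact: (brownian_adapted HF HW).
have aM : adapted (F r) (fun w => Z w * (M r w - M s w)).
  apply: measurable_funM => //; apply: measurable_funB.
    exact: (compensated_adapted HF HN).
  by apply: (filtration_adapted HF s0 (ltW sr)); exact: (compensated_adapted HF HN).
have [i1 E1] := independent_meanM (compensated_independent HF HN r0 rt aA)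
  iZA (L2_L1 (compensated_L2 HF lambda0 HN r0 rt)).
have [i2 E2] := independent_meanM (brownian_coord_independent_past HF HW i r0 rt aM)
  iZM (L2_L1 (brownian_L2 HF HW i r0 rt)).
have i0 := L1_ZAM s0 (lexx s) sr aZ iZ.
have i3 := L1_ZAM s0 (ltW sr) rt aZ iZ.
rewrite -[RHS]addr0 -[X in _ + X](_ : E (fun w =>
    Z w * (A r w - A s w) * (M t w - M r w) +
    Z w * (M r w - M s w) * (A t w - A r w)) = 0); last first.
  rewrite meanD// E1 E2 (compensated_mean HF lambda0 HN)// (brownian_mean HF HW)//.
  by rewrite !mulr0 addr0.
rewrite -meanD// -meanD//; [|exact: L1D|exact: L1D].
by congr mean; apply/funext => w; ring.
Qed.

Let N_int s t w : `|Nr t w - Nr s w| = 0 \/ 1 <= `|Nr t w - Nr s w|.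
Proof.
have [Nst|Nts] := leqP (N s w) (N t w).
  rewrite -natrB// normr_nat; case: (_ - _)%N => [|n]; first by left.
  by right; rewrite ler1n.
rewrite distrC -natrB 1?ltnW// normr_nat.
by right; rewrite ler1n subn_gt0.
Qed.

(** The bound has two parts: a first-order term in the length [t - r] that is small
    because of the factor 1 / J, and second-order terms. The compensator of the
    Poisson process drops out because the Brownian increment is centred. *)
Let orthog_bound J s r t Z : 0 < J -> 0 <= s -> s <= r -> r < t ->
  adapted (F s) Z -> L1 P Z ->
  `|E (fun w => Z w * ((A t w - A r w) * (M t w - M r w)))| <=
  E (fun w => `|Z w|) *
    ((lambda * (t - r) + (lambda * (t - r)) ^+ 2) / J + J ^+ 3 * (64 * (t - r) ^+ 2)).
Proof.
move=> J0 s0 sr rt aZ iZ; have r0 := le_trans s0 sr.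
have aZr := filtration_adapted HF s0 sr aZ.
have aZn : adapted (F r) (fun w => `|Z w|) by exact: measurableT_comp.
have iZn := L1_norm iZ.
have [i4 E4] := brownian_moment4 HF HW i r0 rt.
have indA4 : independent P (fun w => `|Z w|) (fun w => (A t w - A r w) ^+ 4).
  apply: (@independent_compr _ _ _ _ _ (fun w => A t w - A r w) (fun x => x ^+ 4)).
    exact: measurable_funX.
  exact: (brownian_coord_independent_past HF HW i).
have indN2 : independent P (fun w => `|Z w|) (fun w => (Nr t w - Nr r w) ^+ 2).
  apply: (@independent_compr _ _ _ _ _ (fun w => Nr t w - Nr r w) (fun x => x ^+ 2)).
    exact: measurable_funX.
  exact: (poisson_independent HF HN).
have [iA EA] := independent_meanM indA4 iZn i4.
have [iN EN] := independent_meanM indN2 iZn (poisson_L2 HF lambda0 HN r0 rt).2.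
have [iZA EZA] := independent_meanM (brownian_coord_independent_past HF HW i r0 rt aZr)
  iZ (L2_L1 (brownian_L2 HF HW i r0 rt)).
have iZM := L1_ZAM s0 sr rt aZ iZ.
have -> : E (fun w => Z w * ((A t w - A r w) * (M t w - M r w))) =
    E (fun w => Z w * ((A t w - A r w) * (M t w - M r w)) +
       lambda * (t - r) * (Z w * (A t w - A r w))).
  by rewrite meanD ?meanZ// ?EZA ?(brownian_mean HF HW) ?mulr0 ?addr0//; exact: L1Z.
set Y := fun w => _ + _.
have iY : L1 P Y by apply: L1D => //; exact: L1Z.
apply: le_trans (le_normr_Rintegral _ iY) _ => //.
have -> : E (fun w => `|Z w|) *
    ((lambda * (t - r) + (lambda * (t - r)) ^+ 2) / J + J ^+ 3 * (64 * (t - r) ^+ 2)) =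
  J^-1 * (E (fun w => `|Z w|) * (lambda * (t - r) + (lambda * (t - r)) ^+ 2)) +
  J ^+ 3 * (E (fun w => `|Z w|) * (64 * (t - r) ^+ 2)) by ring.
apply: (@le_trans _ _ (E (fun w => J^-1 * (`|Z w| * (Nr t w - Nr r w) ^+ 2) +
   J ^+ 3 * (`|Z w| * (A t w - A r w) ^+ 4)))).
  apply: mean_le; [exact: L1_norm|by apply: L1D; exact: L1Z|move=> w].
  rewrite /Y compensatedB.
  rewrite (_ : _ + _ = Z w * ((A t w - A r w) * (Nr t w - Nr r w))); last by ring.
  rewrite !normrM.
  have := mul_le_sqr_D_expr4 J0 (normr_ge0 (A t w - A r w)) (N_int r t w).
  rewrite -!normrX !(@ger0_norm _ (_ ^+ _)) ?exprn_even_ge0// => h.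
  have := ler_wpM2l (normr_ge0 (Z w)) h; rewrite mulrDr => {}h.
  apply: le_trans h _; rewrite le_eqVlt; apply/orP; left; apply/eqP.
  by ring.
rewrite meanD; [|exact: L1Z|exact: L1Z].
rewrite !meanZ// EA EN (poisson_increment_moment2 HF lambda0 HN)// lerD2l.
apply: ler_wpM2l; first exact/exprn_ge0/ltW.
by apply: ler_wpM2l => //; exact: mean_ge0.
Qed.

(** The interval is cut into k + 1 pieces of length [h]. *)
Let orthog_partition J s h Z k : 0 < J -> 0 <= s -> 0 < h ->
  adapted (F s) Z -> L1 P Z ->
  let t := s + k.+1%:R * h in
  `|E (fun w => Z w * ((A t w - A s w) * (M t w - M s w)))| <=
  k.+1%:R * (E (fun w => `|Z w|) *
    ((lambda * h + (lambda * h) ^+ 2) / J + J ^+ 3 * (64 * h ^+ 2))).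
Proof.
move=> J0 s0 h0 aZ iZ; elim: k => [|k IH] /=.
  rewrite !mul1r; apply: le_trans (orthog_bound J0 s0 (lexx s) _ aZ iZ) _.
    by rewrite ltrDl.
  by rewrite (addrC s h) addrK.
have kh : 0 < k.+1%:R * h by rewrite mulr_gt0.
rewrite (@orthog_add s (s + k.+1%:R * h))//; last 2 first.
- by rewrite ltrDl.
- by rewrite ltrD2l ltr_pM2r// ltr_nat.
apply: le_trans (ler_normD _ _) _.
rewrite -(natr1 k.+1) [leRHS]mulrDl mul1r lerD//.
have e : s + k.+2%:R * h - (s + k.+1%:R * h) = h by rewrite -(natr1 k.+1); ring.
rewrite -[X in lambda * X]e -[X in 64 * X ^+ 2]e.
rewrite -(natr1 k.+1); apply: (@orthog_bound J s) => //.
- by rewrite lerDl ltW.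
- by rewrite ltrD2l ltr_pM2r// ltrDl.
Qed.

(** The expectation [Q] is estimated on a partition into J^4 pieces, J = j + 1: the
    first-order terms add up to a multiple of 1 / J, and so do the second-order
    terms, since J^3 (H / J^4)^2 J^4 = H^2 / J. Thus |Q| J is bounded
    uniformly in J, and Q = 0. *)
Lemma orthogonal_increments s t Z : 0 <= s -> s < t -> adapted (F s) Z -> L1 P Z ->
  L1 P (fun w => Z w * ((A t w - A s w) * (M t w - M s w))) /\
  E (fun w => Z w * ((A t w - A s w) * (M t w - M s w))) = 0.
Proof.
move=> s0 st aZ iZ; split; first by apply: L1_ZAM (lexx s) st aZ iZ.
set Q := E _; set H := t - s; have H0 : 0 < H by rewrite subr_gt0.
set z := E (fun w => `|Z w|); have z0 : 0 <= z by exact: mean_ge0.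
set B := z * (lambda * H + (lambda * H) ^+ 2 + 64 * H ^+ 2).
have bnd j : `|Q| * j.+1%:R <= B.
  pose J : R := j.+1%:R; pose k := (j.+1 ^ 4).-1.
  have J0 : 0 < J by rewrite ltr0n.
  have J1 : 1 <= J by rewrite ler1n.
  have kE : k.+1%:R = J ^+ 4 :> R.
    by rewrite /k prednK ?expn_gt0// natrX.
  have h0 : 0 < H / J ^+ 4 by rewrite divr_gt0 ?exprn_gt0.
  have := @orthog_partition J s (H / J ^+ 4) Z k J0 s0 h0 aZ iZ.
  rewrite kE/= mulrCA divff ?gt_eqF ?exprn_gt0// mulr1.
  rewrite /H [s + (t - s)]addrC subrK -/H -/Q -/z => h.
  rewrite -/J.
  have := ler_wpM2r (ltW J0) h; move/le_trans; apply.
  have swap S : J ^+ 4 * (z * S) * J = z * (J ^+ 4 * (S * J)) by ring.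
  rewrite swap /B; apply: ler_wpM2l => //.
  set x := lambda * H.
  have -> : J ^+ 4 * (((lambda * (H / J ^+ 4) + (lambda * (H / J ^+ 4)) ^+ 2) / J +
     J ^+ 3 * (64 * (H / J ^+ 4) ^+ 2)) * J) = x + x ^+ 2 / J ^+ 4 + 64 * H ^+ 2.
    by rewrite /x; field; rewrite gt_eqF.
  rewrite lerD2r lerD2l ler_pdivrMr ?exprn_gt0// ler_peMr ?sqr_ge0//.
  by rewrite exprn_ege1.
apply/eqP; rewrite -normr_eq0; apply/negP => /negP Q0.
have Qp : 0 < `|Q| by rewrite lt_def Q0 normr_ge0.
have := bnd (Num.truncn (B / `|Q|)); rewrite leNgt => /negP; apply.
by rewrite mulrC -ltr_pdivrMr// truncnS_gt.
Qed.

End Orthogonality.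

(** * Measurability of the coefficients of the scheme *)

Section BorelCoefficients.
Context {R : realType} {d : nat}.

(** In the ball of radius delta of the sup norm, the Euclidean distance to the
    centre is at most (d + 1) delta, so a Lipschitz function is continuous. *)
Lemma lipschitz_borel (phi : 'cV[R]_d -> R) (L : R) :
  (forall x y, `|phi x - phi y| <= L * enorm (x - y)) ->
  measurable_fun [set: borelType d] phi.
Proof.
move=> lip; apply: continuous_borel => x.
apply/(@cvgrPdist_le _ _ _ (nbhs x) (nbhs_filter x)) => e e0.
pose c := (`|L| + 1) * d.+1%:R.
have L0 : 0 < `|L| + 1 by rewrite ltr_wpDl.
have c0 : 0 < c by rewrite /c mulr_gt0.
have ec : 0 < e / c by rewrite divr_gt0.
apply: (@filterS _ (nbhs x) (nbhs_filter x) _ _ _ (nbhsx_ballx x (e / c) ec)) => y [_ xy].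
have nxy : enorm (x - y) <= d.+1%:R * (e / c).
  have dec : 0 <= d.+1%:R * (e / c) by apply: mulr_ge0 => //; exact: ltW.
  rewrite -(ler_pXn2r (n := 2)) ?nnegrE ?enorm_ge0// enorm_cV.
  apply: (@le_trans _ _ (\sum_(i < d) (e / c) ^+ 2)).
    apply: ler_sum => i _; rewrite -[leLHS]real_normK ?num_real//.
    rewrite ler_pXn2r ?nnegrE ?normr_ge0 ?(ltW ec)//.
    by have := xy i 0; rewrite /ball/= !mxE => ?; exact: ltW.
  rewrite sumr_const card_ord -[leLHS]mulr_natl [leRHS]exprMn; apply: ler_wpM2r.
    exact: sqr_ge0.
  rewrite -natrX ler_nat (leq_trans (leqnSn d))//.
  by rewrite -{1}(muln1 d.+1) expnS leq_mul// expn1.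
apply: le_trans (lip x y) _; apply: (@le_trans _ _ ((`|L| + 1) * enorm (x - y))).
  by rewrite ler_wpM2r ?enorm_ge0// (le_trans (ler_norm _))// lerDl.
apply: (@le_trans _ _ ((`|L| + 1) * (d.+1%:R * (e / c)))).
  by rewrite ler_pM2l.
rewrite le_eqVlt; apply/orP; left; apply/eqP; rewrite /c; field.
by rewrite gt_eqF//= pnatr_eq0.
Qed.

Lemma lipschitz_entry_borel m (G : 'cV[R]_d -> 'M[R]_(d, m)) (L : R) i j :
  (forall x y, enorm (G x - G y) <= L * enorm (x - y)) ->
  measurable_fun [set: borelType d] (fun x => G x i j).
Proof.
move=> lip; apply: (@lipschitz_borel _ L) => x y; apply: le_trans (lip x y).
by have := entry_le_enorm (G x - G y) i j; rewrite !mxE.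
Qed.

Lemma enorm_borel (phi : 'cV[R]_d -> 'cV[R]_d) :
  (forall i, measurable_fun [set: borelType d] (fun x => phi x i 0)) ->
  measurable_fun [set: borelType d] (fun x => enorm (phi x)).
Proof.
move=> mphi.
have -> : (fun x => enorm (phi x)) = (fun x => Num.sqrt (\sum_i phi x i 0 ^+ 2)).
  by apply/funext => x; rewrite /enorm; congr Num.sqrt; apply: eq_bigr => i _;
    rewrite big_ord1.
apply: (measurableT_comp (continuous_measurable_fun (@sqrt_continuous R))).
by apply: measurable_sum => i; apply: measurable_funX; exact: mphi.
Qed.

(** The absolute value keeps the denominator away from 0, so that the function is
    continuous on the whole line; it is applied to norms. *)
Lemma taming_measurable (D : R) : 0 < D ->
  measurable_fun [set: R] (fun t : R => D / (1 + D * `|t|)).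
Proof.
move=> D0; apply: continuous_measurable_fun => t.
have p : 0 < 1 + D * `|t| by rewrite ltr_pwDl// mulr_ge0// ltW.
apply: cvgM; first exact: cvg_cst.
apply: cvgV; first by rewrite gt_eqF.
apply: cvgD; first exact: cvg_cst.
apply: cvgM; first exact: cvg_cst.
exact: cvg_norm.
Qed.

End BorelCoefficients.

(** * One step of the scheme, and stability *)

Section Scheme.
Context {dT : measure_display} {T : measurableType dT} {R : realType}.
Variables (P : probability T R) (d m : nat) (F : R -> set (set T)) (lambda : R).
Variables (W : R -> T -> 'cV[R]_m) (N : R -> T -> nat) (X0 : T -> 'cV[R]_d).
Variables (f u v h : 'cV[R]_d -> 'cV[R]_d) (g : 'cV[R]_d -> 'M[R]_(d, m)).
Variables (rho beta betabar theta K C a D : R).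
Hypotheses (HF : filtration F) (lambda0 : 0 < lambda).
Hypotheses (HW : brownian_motion P F W) (HN : poisson_process P F lambda N).
Hypothesis X0F : measurable_wrt (F 0) (borel 'cV[R]_d) X0.
Hypothesis X0L2 : ('E_P[fun w => (enorm (X0 w) ^+ 2)%R] < +oo)%E.
Hypothesis f_borel : measurable_wrt (borel 'cV[R]_d) (borel 'cV[R]_d) f.
Hypothesis fE : forall x, f x = u x + v x.
Hypotheses (f0 : f 0 = 0) (g0 : g 0 = 0) (h0 : h 0 = 0).
Hypotheses (rho0 : 0 < rho) (beta0 : 0 < beta) (betabar0 : 0 < betabar).
Hypotheses (theta0 : 0 < theta) (K0 : 0 < K) (C0 : 0 < C) (a1 : 1 < a).
Hypothesis u_mono :
  forall x y, dotv (x - y) (u x - u y) <= - rho * enorm (x - y) ^+ 2.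
Hypothesis u_lip : forall x y, enorm (u x - u y) <= K * enorm (x - y).
Hypothesis v_mono : forall x y,
  dotv (x - y) (v x - v y) <= - beta * enorm (x - y) `^ (a + 1).
Hypothesis v_growth : forall x, enorm (v x) <= betabar * enorm x `^ a.
Hypothesis g_lip : forall x y, enorm (g x - g y) <= theta * enorm (x - y).
Hypothesis h_lip : forall x y, enorm (h x - h y) <= C * enorm (x - y).
Hypothesis D0 : 0 < D.
Hypothesis D1 : D * ((2 * (K + lambda * C) + betabar) * betabar) <= 2 * beta.
Hypothesis D2 : D * (2 * (K + lambda * C) * betabar) <= 2 * beta - betabar.

Local Notation Y := (semi_tamed_euler u v h g lambda W N X0 D).
Local Notation M := (compensated lambda N).
Local Notation E := (mean P).

(** The factor 1 + D alpha1 + D^2 (K + lambda C)^2. *)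
Definition contraction_rate : R :=
  1 + D * (- 2 * rho + theta ^+ 2 + lambda * C * (2 + C)) +
  D ^+ 2 * (K + lambda * C) ^+ 2.

Definition euler_drift (x : 'cV[R]_d) : 'cV[R]_d :=
  x + D *: (u x + lambda *: h x) + (D / (1 + D * enorm (v x))) *: v x.

Let v00 : v 0 = 0.
Proof.
have an0 : a != 0 by rewrite gt_eqF// (lt_trans ltr01 a1).
have := v_growth 0; rewrite enorm0 powR0//.
rewrite mulr0 => v0; apply/matrixP => i j; rewrite mxE; apply/eqP.
by rewrite -normr_le0; apply: le_trans (entry_le_enorm _ _ _) v0.
Qed.

Let u00 : u 0 = 0.
Proof. by have := fE 0; rewrite f0 v00 addr0. Qed.

Let g_norm x : enorm (g x) <= theta * enorm x.
Proof. by have := g_lip x 0; rewrite g0 !subr0. Qed.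

Let h_norm x : enorm (h x) <= C * enorm x.
Proof. by have := h_lip x 0; rewrite h0 !subr0. Qed.

Let u_norm x : enorm (u x) <= K * enorm x.
Proof. by have := u_lip x 0; rewrite u00 !subr0. Qed.

Lemma euler_drift_bound x : enorm (euler_drift x) ^+ 2 <=
  (1 + 2 * D * (- rho + lambda * C) + D ^+ 2 * (K + lambda * C) ^+ 2) *
  enorm x ^+ 2.
Proof.
apply: (@tamed_drift_bound _ _ _ _ _ _ _ beta betabar a) => //.
- by rewrite addr_gt0// mulr_gt0.
- apply: le_trans (enormD _ _) _; rewrite mulrDl lerD ?u_norm//.
  by rewrite (enormZ _ (ltW lambda0)) -mulrA ler_pM2l.
- rewrite dotvDr dotvZr mulrDl; apply: lerD.
    by have := u_mono x 0; rewrite u00 !subr0.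
  rewrite -mulrA ler_pM2l//; apply: le_trans (cauchy_schwarz _ _) _.
  by rewrite expr2 mulrCA ler_wpM2l ?enorm_ge0.
- by have := v_mono x 0; rewrite v00 !subr0.
Qed.

Lemma one_step_contraction x :
  enorm (euler_drift x) ^+ 2 + lambda * D * enorm (h x) ^+ 2 +
  D * enorm (g x) ^+ 2 <= contraction_rate * enorm x ^+ 2.
Proof.
have hb : enorm (h x) ^+ 2 <= C ^+ 2 * enorm x ^+ 2.
  rewrite -exprMn ler_pXn2r ?nnegrE ?enorm_ge0 ?h_norm//.
  by apply: mulr_ge0; [exact: ltW|exact: enorm_ge0].
have gb : enorm (g x) ^+ 2 <= theta ^+ 2 * enorm x ^+ 2.
  rewrite -exprMn ler_pXn2r ?nnegrE ?enorm_ge0 ?g_norm//.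
  by apply: mulr_ge0; [exact: ltW|exact: enorm_ge0].
have lD : 0 <= lambda * D by apply: mulr_ge0; exact: ltW.
have := euler_drift_bound x.
have := ler_wpM2l lD hb; have := ler_wpM2l (ltW D0) gb.
rewrite /contraction_rate; lra.
Qed.

(** This is where Borel measurability of f enters: v is not Lipschitz, but it is
    the difference of f and the Lipschitz map u. *)
Let v_borel i : measurable_fun [set: borelType d] (fun x => v x i 0).
Proof.
have -> : (fun x => v x i 0) = (fun x => f x i 0 - u x i 0).
  by apply/funext => x; rewrite fE mxE; ring.
apply: measurable_funB; last exact: lipschitz_entry_borel u_lip.
have mf := @continuous_borel R d (fun x => x i 0) (@coord_continuous _ _ _ i 0).
move=> _ B mB; rewrite setTI.
have := mf measurableT B mB; rewrite setTI => /f_borel.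
exact.
Qed.

Lemma euler_drift_borel i :
  measurable_fun [set: borelType d] (fun x => euler_drift x i 0).
Proof.
have -> : (fun x => euler_drift x i 0) = (fun x => x i 0 +
    D * (u x i 0 + lambda * h x i 0) + D / (1 + D * `|enorm (v x)|) * v x i 0).
  by apply/funext => x; rewrite /euler_drift !mxE ger0_norm ?enorm_ge0.
apply: measurable_funD; first apply: measurable_funD.
- exact: (continuous_borel (@coord_continuous _ _ _ i 0)).
- apply: measurable_funM => //; apply: measurable_funD.
    exact: lipschitz_entry_borel u_lip.
  by apply: measurable_funM => //; exact: lipschitz_entry_borel h_lip.
- apply: measurable_funM; last exact: v_borel.
  have mv := enorm_borel v_borel.
  exact: (measurableT_comp (taming_measurable D0) mv).
Qed.

Let adapted_comp t (Z : T -> 'cV[R]_d) (phi : 'cV[R]_d -> R) : 0 <= t ->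
  (forall i, adapted (F t) (fun w => Z w i 0)) ->
  measurable_fun [set: borelType d] phi -> adapted (F t) (fun w => phi (Z w)).
Proof. by move=> t0 aZ mphi; exact: (measurableT_comp mphi (coord_adapted aZ)). Qed.

(** The index type of the noise joins the single Poisson component to the [m]
    Brownian components, so that one lemma handles all of them. *)
Definition noise s t (k : 'I_1 + 'I_m) (w : T) : R :=
  match k with
  | inl _ => M t w - M s w
  | inr j => W t w j 0 - W s w j 0
  end.

Definition noise_coef (x : 'cV[R]_d) (i : 'I_d) (k : 'I_1 + 'I_m) : R :=
  match k with inl _ => h x i 0 | inr j => g x i j end.

Lemma euler_step n w i :
  Y n.+1 w i 0 = euler_drift (Y n w) i 0 +
    \sum_k noise_coef (Y n w) i k * noise (n%:R * D) (n.+1%:R * D) k w.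
Proof.
rewrite /= big_sumType big_ord1/= /euler_drift !mxE.
under [in LHS]eq_bigr do rewrite !mxE.
ring.
Qed.

Let time_ge0 n : 0 <= n%:R * D.
Proof. by apply: mulr_ge0 => //; exact: ltW. Qed.

Let time_lt n : n%:R * D < n.+1%:R * D.
Proof. by rewrite ltr_pM2r// ltr_nat. Qed.

Let timeB n : n.+1%:R * D - n%:R * D = D.
Proof. by rewrite -natr1; ring. Qed.

Let coef_borel i k : measurable_fun [set: borelType d] (fun x => noise_coef x i k).
Proof.
case: k => [z|j]; first exact: lipschitz_entry_borel h_lip.
exact: lipschitz_entry_borel g_lip.
Qed.

Lemma euler_adapted n i : adapted (F (n%:R * D)) (fun w => Y n w i 0).
Proof.
elim: n i => [|n IH] i.
  by rewrite mul0r; apply: adapted_coord; [exact: (filtration_sigma HF)|exact: X0F].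
have up Z := @filtration_adapted _ _ _ _ HF _ _ Z (time_ge0 n) (ltW (time_lt n)).
under eq_fun do rewrite euler_step.
apply: measurable_funD.
  by apply: up; exact: adapted_comp (time_ge0 n) IH (euler_drift_borel i).
apply: measurable_sum => k; apply: measurable_funM.
  by apply: up; exact: adapted_comp (time_ge0 n) IH (coef_borel i k).
case: k => [z|j] /=; apply: measurable_funB.
- exact: (compensated_adapted HF HN).
- by apply: up; exact: (compensated_adapted HF HN).
- exact: (brownian_adapted HF HW).
- by apply: up; exact: (brownian_adapted HF HW).
Qed.

Let adapted_sqr_le n (Z : T -> R) c : adapted (F (n%:R * D)) Z ->
  L1 P (fun w => enorm (Y n w) ^+ 2) ->
  (forall w, Z w ^+ 2 <= c * enorm (Y n w) ^+ 2) -> L2 P Z.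
Proof.
move=> aZ iY ZY; have mZ := filtration_measurable HF (time_ge0 n) aZ.
split => //; apply: (L1_le _ _ (L1Z c iY)); first exact: measurable_funX.
by move=> w; rewrite ger0_norm ?sqr_ge0.
Qed.

(** [noise_second_moment] is applied to each coordinate of the new iterate; summing
    over the coordinates recovers the norms of the drift, of [h] and of [g]. *)
Lemma euler_step_moment n : L1 P (fun w => enorm (Y n w) ^+ 2) ->
  L1 P (fun w => enorm (Y n.+1 w) ^+ 2) /\
  E (fun w => enorm (Y n.+1 w) ^+ 2) <=
  contraction_rate * E (fun w => enorm (Y n w) ^+ 2).
Proof.
move=> iY.
set s := n%:R * D; set t := n.+1%:R * D.
have s0 : 0 <= s := time_ge0 n.
have st : s < t := time_lt n.
pose b i w := euler_drift (Y n w) i 0.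
pose c i k w := noise_coef (Y n w) i k.
pose tau (k : 'I_1 + 'I_m) : R := match k with inl _ => lambda * D | inr _ => D end.
have ab i : adapted (F s) (b i).
  exact: (@adapted_comp s (Y n) (fun x => euler_drift x i 0) s0
    (@euler_adapted n) (euler_drift_borel i)).
have ac i k : adapted (F s) (c i k).
  exact: (@adapted_comp s (Y n) (fun x => noise_coef x i k) s0
    (@euler_adapted n) (coef_borel i k)).
have ib i : L2 P (b i).
  apply: adapted_sqr_le (ab i) iY _ => w.
  exact: le_trans (entry_sqr_le _ _ _) (euler_drift_bound _).
have ic i k : L2 P (c i k).
  case: k => [k|j].
    apply: (@adapted_sqr_le n _ (C ^+ 2) (ac i (inl k)) iY) => w.
    rewrite -exprMn; apply: le_trans (entry_sqr_le _ _ _) _.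
    rewrite ler_pXn2r ?nnegrE ?enorm_ge0 ?h_norm//.
    by apply: mulr_ge0; [exact: ltW|exact: enorm_ge0].
  apply: (@adapted_sqr_le n _ (theta ^+ 2) (ac i (inr j)) iY) => w.
  rewrite -exprMn; apply: le_trans (entry_sqr_le _ _ _) _.
  rewrite ler_pXn2r ?nnegrE ?enorm_ge0 ?g_norm//.
  by apply: mulr_ge0; [exact: ltW|exact: enorm_ge0].
have xi_L2 k : L2 P (noise s t k).
  case: k => [z|j]; first exact: (compensated_L2 HF lambda0 HN s0 st).
  exact: (brownian_L2 HF HW j s0 st).
have xi_indep k (Z : T -> R) : adapted (F s) Z -> independent P Z (noise s t k).
  move=> aZ; case: k => [z|j]; first exact: (compensated_independent HF HN s0 st aZ).
  exact: (brownian_coord_independent_past HF HW j s0 st aZ).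
have xi_mean k : E (noise s t k) = 0.
  case: k => [z|j]; first exact: (compensated_mean HF lambda0 HN s0 st).
  exact: (brownian_mean HF HW j s0 st).
have xi_var k : E (fun w => noise s t k w ^+ 2) <= tau k.
  case: k => [z|j] /=.
    by rewrite (compensated_var HF lambda0 HN s0 st) /s /t timeB.
  by rewrite -(timeB n); exact: (brownian_var HF HW j s0 st).
have xi_orth k l (Z : T -> R) : k != l -> adapted (F s) Z -> L1 P Z ->
    E (fun w => Z w * (noise s t k w * noise s t l w)) = 0.
  case: k l => [k|j] [l|j'] kl aZ iZ /=.
  - by move: kl; rewrite !ord1 eqxx.
  - under eq_fun do rewrite [X in _ * X]mulrC.
    exact: (orthogonal_increments HF HW lambda0 HN j' s0 st aZ iZ).2.
  - exact: (orthogonal_increments HF HW lambda0 HN j s0 st aZ iZ).2.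
  - by apply: (brownian_orthogonal HF HW) => //; apply: contra kl => /eqP ->.
have coord i := noise_second_moment xi_L2 xi_indep xi_mean xi_var xi_orth
  (ab i) (ib i) (ac i) (ic i).
have YE i : (fun w => Y n.+1 w i 0) =
    (fun w => b i w + \sum_k c i k w * noise s t k w).
  by apply/funext => w; rewrite euler_step.
have iYi i : L2 P (fun w => Y n.+1 w i 0) by rewrite YE; exact: (coord i).1.
have -> : (fun w => enorm (Y n.+1 w) ^+ 2) = (fun w => \sum_i Y n.+1 w i 0 ^+ 2).
  by apply/funext => w; rewrite enorm_cV.
split; first by apply: L1_sum => i; exact: (iYi i).2.
rewrite mean_sum; last by move=> i; exact: (iYi i).2.
apply: (@le_trans _ _ (\sum_i (E (fun w => b i w ^+ 2) +
    \sum_k tau k * E (fun w => c i k w ^+ 2)))).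
  apply: ler_sum => i _.
  have -> : (fun w => Y n.+1 w i 0 ^+ 2) =
    (fun w => (b i w + \sum_k c i k w * noise s t k w) ^+ 2).
    by apply/funext => w; rewrite euler_step.
  exact: (coord i).2.
have iS i : L1 P (fun w => \sum_k tau k * c i k w ^+ 2).
  by apply: L1_sum => k; exact: (L1Z _ (ic i k).2).
have iT : L1 P (fun w => \sum_i (b i w ^+ 2 + \sum_k tau k * c i k w ^+ 2)).
  by apply: L1_sum => i; exact: (L1D (ib i).2 (iS i)).
have -> : \sum_i (E (fun w => b i w ^+ 2) + \sum_k tau k * E (fun w => c i k w ^+ 2)) =
    E (fun w => \sum_i (b i w ^+ 2 + \sum_k tau k * c i k w ^+ 2)).
  rewrite mean_sum; last by move=> i; exact: (L1D (ib i).2 (iS i)).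
  apply: eq_bigr => i _; rewrite (meanD (ib i).2 (iS i)); congr (_ + _).
  rewrite mean_sum; last by move=> k; exact: (L1Z _ (ic i k).2).
  by apply: eq_bigr => k _; rewrite (meanZ _ (ic i k).2).
rewrite -(meanZ _ iY); apply: mean_le => //; first exact: (L1Z _ iY).
move=> w; apply: le_trans (one_step_contraction _).
rewrite le_eqVlt; apply/orP; left; apply/eqP.
rewrite big_split/= -enorm_cV -addrA; congr (_ + _).
rewrite enorm_cV enorm_sqr !mulr_sumr -big_split; apply: eq_bigr => i _ /=.
by rewrite big_sumType big_ord1/= mulr_sumr.
Qed.

Lemma initial_L1 : L1 P (fun w => enorm (X0 w) ^+ 2).
Proof.
have mX i : measurable_fun setT (fun w => X0 w i 0).
  apply: (filtration_measurable HF (lexx 0)).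
  by apply: adapted_coord => //; exact: (filtration_sigma HF).
apply/integrableP; split.
  apply/measurable_EFinP; under eq_fun do rewrite enorm_cV.
  by apply: measurable_sum => i; apply: measurable_funX; exact: mX.
under eq_integral do rewrite /= ger0_norm ?sqr_ge0//.
by move: X0L2; rewrite unlock.
Qed.

Lemma euler_moment_decay n q : contraction_rate <= q -> 0 <= q ->
  L1 P (fun w => enorm (Y n w) ^+ 2) /\
  E (fun w => enorm (Y n w) ^+ 2) <= q ^+ n * E (fun w => enorm (X0 w) ^+ 2).
Proof.
move=> rq q0; elim: n => [|n [iY IH]].
  by split; [exact: initial_L1|rewrite expr0 mul1r].
have [iY' step] := euler_step_moment iY; split => //.
apply: le_trans step _; rewrite exprS -mulrA.
apply: (@le_trans _ _ (q * E (fun w => enorm (Y n w) ^+ 2))).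
  by apply: ler_wpM2r => //; apply: mean_ge0 => w; exact: sqr_ge0.
exact: ler_wpM2l.
Qed.

Lemma expectation_mean (Z : T -> R) : L1 P Z -> ('E_P[Z] = (mean P Z)%:E)%E.
Proof. by move=> iZ; rewrite unlock /mean fineK//; exact: integrable_fin_num. Qed.

Lemma euler_stable : contraction_rate < 1 -> exp_mean_square_stable P X0 D Y.
Proof.
(* The rate is replaced by a number in ]0, 1[ before its logarithm is taken. *)
move=> r1; pose q := Num.max contraction_rate 2^-1.
have rq : contraction_rate <= q by rewrite le_max lexx.
have q0 : 0 < q by rewrite lt_max invr_gt0 ltr0n orbT.
have q1 : q < 1 by rewrite gt_max r1/= invf_lt1// ltr1n.
exists (- ln q / D), 1; split => //.
  by rewrite divr_gt0// oppr_gt0 ln_lt0// q0.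
move=> n; have [iY decay] := euler_moment_decay n rq (ltW q0).
rewrite !expectation_mean//; last exact: initial_L1.
rewrite mul1r -EFinM lee_fin (_ : - (- ln q / D) * n%:R * D = n%:R * ln q).
  by rewrite expRM_natl lnK// posrE.
by field; rewrite gt_eqF.
Qed.

End Scheme.

Unset Implicit Arguments.

Theorem theorem5p6p3 (dT : measure_display) (T : measurableType dT)
  (R : realType) (P : probability T R) (d m : nat)
  (F : R -> set (set T)) (lambda : R)
  (W : R -> T -> 'cV[R]_m) (N : R -> T -> nat) (X0 : T -> 'cV[R]_d)
  (f u v h : 'cV[R]_d -> 'cV[R]_d) (g : 'cV[R]_d -> 'M[R]_(d, m))
  (rho beta betabar theta K C a dt : R)
  (Pcomplete : measure_is_complete P)
  (HF : filtration F)
  (lambda0 : 0 < lambda)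
  (HW : brownian_motion P F W)
  (HN : poisson_process P F lambda N)
  (X0F : measurable_wrt (F 0) (borel 'cV[R]_d) X0)
  (X0L2 : ('E_P[fun w => (enorm (X0 w) ^+ 2)%R] < +oo)%E)
  (* Borel measurability of the drift, implicit in the equation being
     meaningful; u, g, h are Lipschitz, so v is then Borel as well *)
  (f_borel : measurable_wrt (borel 'cV[R]_d) (borel 'cV[R]_d) f)
  (fE : forall x, f x = u x + v x)
  (f0 : f 0 = 0) (g0 : g 0 = 0) (h0 : h 0 = 0)
  (rho0 : 0 < rho) (beta0 : 0 < beta) (betabar0 : 0 < betabar)
  (theta0 : 0 < theta) (K0 : 0 < K) (C0 : 0 < C) (a1 : 1 < a)
  (u_mono : forall x y, dotv (x - y) (u x - u y) <= - rho * enorm (x - y) ^+ 2)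
  (u_lip : forall x y, enorm (u x - u y) <= K * enorm (x - y))
  (v_mono : forall x y,
    dotv (x - y) (v x - v y) <= - beta * enorm (x - y) `^ (a + 1))
  (v_growth : forall x, enorm (v x) <= betabar * enorm x `^ a)
  (g_lip : forall x y, enorm (g x - g y) <= theta * enorm (x - y))
  (h_lip : forall x y, enorm (h x - h y) <= C * enorm (x - y))
  (beta_gt : 0 < 2 * beta - betabar)
  (dt0 : 0 < dt) :
  let alpha1 := - 2 * rho + theta ^+ 2 + lambda * C * (2 + C) in
  dt < Num.min (- alpha1 / (K + lambda * C) ^+ 2)
         (Num.min (2 * beta / ((2 * (K + lambda * C) + betabar) * betabar))
            ((2 * beta - betabar) / (2 * (K + lambda * C) * betabar))) ->
  exp_mean_square_stable P X0 dt (semi_tamed_euler u v h g lambda W N X0 dt).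
Proof.
move=> alpha1; rewrite !lt_min => /and3P[dt1 dt2 dt3].
have A0 : 0 < K + lambda * C by rewrite addr_gt0// mulr_gt0.
apply: (@euler_stable _ _ _ P d m F lambda W N X0 f u v h g
  rho beta betabar theta K C a dt) => //.
- move: dt2; rewrite ltr_pdivlMr; first exact: ltW.
  by rewrite mulr_gt0// addr_gt0// mulr_gt0.
- move: dt3; rewrite ltr_pdivlMr; first exact: ltW.
  by rewrite !mulr_gt0.
- rewrite /contraction_rate -/alpha1 -addrA gtrDl expr2 -mulrA -mulrDr pmulr_rlt0//.
  by move: dt1; rewrite ltr_pdivlMr ?exprn_gt0//; lra.
Qed.
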